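(* Let $A$ be a symmetric Frobenius superalgebra over the commutative ring $\Bbbk$ and let $n\in\mathbb{N}$. As a superalgebra, $\mathrm{nilCox}_n(A)=\operatorname{End}_{\mathcal{N}}(\mathsf{I}^{\otimes n})$, where $\mathcal{N}$ is the Frobenius nilCoxeter category of $A$ with generating object $\mathsf{I}$, is isomorphic to the free product of $A^{\otimes n}$ and the free associative superalgebra on even generators $u_1,\dots,u_{n-1}$, subject to the relations \begin{align*} u_i^2&=0, & 1\le i\le n-1,\\ u_iu_j&=u_ju_i, & |i-j|>1,\\ u_iu_{i+1}u_i&=u_{i+1}u_iu_{i+1}, & 1\le i\le n-2,\\ u_i\mathbf{a}&=s_i(\mathbf{a})u_i, & 1\le i\le n-1,\ \mathbf{a}\in A^{\otimes n}. \end{align*} Under this isomorphism, $u_i$ corresponds to $1_{\mathsf{I}}^{\otimes(n-i-1)}\otimes X\otimes1_{\mathsf{I}}^{\otimes(i-1)}$ (the crossing of strands $i$ and $i+1$), and $1^{\otimes(n-i)}\otimes a\otimes1^{\otimes(i-1)}$, $a\in A$, corresponds to $1_{\mathsf{I}}^{\otimes(n-i)}\otimes t_a\otimes1_{\mathsf{I}}^{\otimes(i-1)}$ (a token labeled $a$ on strand $i$), with strands numbered from right to left.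
   Context: All superalgebras are associative, unital and $\mathbb{Z}/2$-graded over $\Bbbk$; $\bar a$ denotes parity; tensor products are over $\Bbbk$, and multiplication in $A\otimes B$ is $(a'\otimes b)(a\otimes b')=(-1)^{\bar a\bar b}a'a\otimes bb'$. A symmetric Frobenius superalgebra is a superalgebra $A$ with a homogeneous $\Bbbk$-linear trace map $\operatorname{tr}\colon A\to\Bbbk$ of parity $\varepsilon\in\mathbb{Z}/2$ (even or odd) such that $\operatorname{tr}(ab)=(-1)^{\bar a\bar b}\operatorname{tr}(ba)$ for $a,b\in A$, and such that $A$ has a $\Bbbk$-basis $\mathbf{B}_A$ with a dual basis $\{b^\vee: b\in\mathbf{B}_A\}$ satisfying $\operatorname{tr}(a^\vee b)=\delta_{a,b}$ for $a,b\in\mathbf{B}_A$. Tensor factors are numbered from right to left, elements of $A^{\otimes n}$ being written $a_n\otimes\cdots\otimes a_1$. The simple transposition $s_i$ acts on $A^{\otimes n}$ by swapping the $i$-th and $(i+1)$-st factors with sign $(-1)^{\bar a_i\bar a_{i+1}}$. A supercategory is a category enriched in $\Bbbk$-supermodules with parity-preserving composition. In a strict monoidal supercategory, morphisms satisfy the super interchange law $(f'\otimes g)\circ(f\otimes g')=(-1)^{\bar f\bar g}(f'\circ f)\otimes(g\circ g')$. The Frobenius nilCoxeter category $\mathcal{N}=\mathcal{N}(A)$ is the strict monoidal $\Bbbk$-linear supercategory generated by one object $\mathsf{I}$ and morphisms $X\colon\mathsf{I}^{\otimes2}\to\mathsf{I}^{\otimes2}$ (even; the crossing) and $t_a\colon\mathsf{I}\to\mathsf{I}$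 for $a\in A$ (of parity $\bar a$; tokens), subject to: $t_1=1_{\mathsf{I}}$; $t_{\lambda a+\mu b}=\lambda t_a+\mu t_b$ for $\lambda,\mu\in\Bbbk$; $t_a\circ t_b=t_{ab}$; $X\circ X=0$; $(X\otimes1_{\mathsf{I}})\circ(1_{\mathsf{I}}\otimes X)\circ(X\otimes1_{\mathsf{I}})=(1_{\mathsf{I}}\otimes X)\circ(X\otimes1_{\mathsf{I}})\circ(1_{\mathsf{I}}\otimes X)$; $X\circ(t_a\otimes1_{\mathsf{I}})=(1_{\mathsf{I}}\otimes t_a)\circ X$; $X\circ(1_{\mathsf{I}}\otimes t_a)=(t_a\otimes1_{\mathsf{I}})\circ X$. *)

(* Defs.v *)
From HB Require Import structures.
From mathcomp Require Import all_boot all_algebra.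
From mathcomp Require Import boolp zify.
Set Implicit Arguments.
Unset Strict Implicit.
Unset Printing Implicit Defensive.
Import GRing.Theory.
Local Open Scope ring_scope.
Local Open Scope quotient_scope.

(* MathComp's [algType] excludes the zero ring, so superalgebras are built here
   directly on [lmodType]; a [pzRingType] structure is derived just below.
   Parities are booleans (true = odd, addition is (+)).  A grading
   A = A_0 (+) A_1 is given by its projections: [hcomp p] is the projection
   onto A_p, so that A_p = {x | hcomp p x = x}; [hcomp_smul] says that
   A_p A_q is contained in A_(p+q). *)
HB.mixin Record Lmodule_isSuperAlgebra (k : comPzRingType) A
    of GRing.Lmodule k A := {
  sone : A;
  smul : A -> A -> A;
  smulA : associative smul;
  smul1x : left_id sone smul;
  smulx1 : right_id sone smul;
  smulDl : left_distributive smul +%R;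
  smulDr : right_distributive smul +%R;
  smulZl : forall (c : k) (x y : A), smul (c *: x) y = c *: smul x y;
  smulZr : forall (c : k) (x y : A), smul x (c *: y) = c *: smul x y;
  hcomp : bool -> A -> A;
  hcompD : forall p, {morph hcomp p : x y / x + y};
  hcompZ : forall p (c : k), {morph hcomp p : x / c *: x};
  hcomp_sum : forall x, hcomp false x + hcomp true x = x;
  hcompK : forall p q x, hcomp p (hcomp q x) = if p == q then hcomp q x else 0;
  hcomp_smul : forall p q x y,
    hcomp (p (+) q) (smul (hcomp p x) (hcomp q y)) =
    smul (hcomp p x) (hcomp q y) }.

#[short(type="superAlgType")]
HB.structure Definition SuperAlgebra (k : comPzRingType) :=
  {A of GRing.Lmodule k A & Lmodule_isSuperAlgebra k A}.

HB.instance Definition _ (k : comPzRingType) (A : superAlgType k) :=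
  GRing.Zmodule_isPzRing.Build (SuperAlgebra.sort A)
    smulA smul1x smulx1 smulDl smulDr.

Definition homog (k : comPzRingType) (A : superAlgType k) (p : bool) (x : A) :=
  hcomp p x = x.

Section SuperAlgebraTheory.
Variables (k : comPzRingType) (A : superAlgType k).
Implicit Types (x y : A) (p q : bool).

Lemma smulE x y : smul x y = x * y. Proof. by []. Qed.
Lemma soneE : sone = 1 :> A. Proof. by []. Qed.

Lemma superAl (c : k) x y : (c *: x) * y = c *: (x * y).
Proof. exact: smulZl. Qed.

Lemma superAr (c : k) x y : x * (c *: y) = c *: (x * y).
Proof. exact: smulZr. Qed.

Lemma hcomp0 p : hcomp p (0 : A) = 0.
Proof. by rewrite -[X in hcomp p X](scale0r (0 : A)) hcompZ scale0r. Qed.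

Lemma hcompN p : {morph hcomp p : x / - x :> A}.
Proof. by move=> x; rewrite -scaleN1r hcompZ scaleN1r. Qed.

Lemma hcompB p : {morph hcomp p : x y / x - y :> A}.
Proof. by move=> x y; rewrite hcompD hcompN. Qed.

Lemma hcompMh p q x y : hcomp (p (+) q) (hcomp p x * hcomp q y) =
  hcomp p x * hcomp q y.
Proof. exact: hcomp_smul. Qed.

Lemma homog_hcomp p x : homog p (hcomp p x).
Proof. by rewrite /homog hcompK eqxx. Qed.

Lemma homog_neq p q x : homog p x -> hcomp q x = if q == p then x else 0.
Proof. by move=> <-; rewrite hcompK. Qed.

Lemma homogM p q x y : homog p x -> homog q y -> homog (p (+) q) (x * y).
Proof. by move=> hx hy; rewrite /homog -hx -hy hcompMh. Qed.

Lemma hcompM r x y : hcomp r (x * y) =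
  hcomp false x * hcomp r y + hcomp true x * hcomp (~~ r) y.
Proof.
rewrite -{1}[x]hcomp_sum -{1}[y]hcomp_sum mulrDl !mulrDr !hcompD.
have E r' p q : hcomp r' (hcomp p x * hcomp q y) =
    if r' == p (+) q then hcomp p x * hcomp q y else 0.
  exact/homog_neq/hcompMh.
by rewrite !E; case: r => /=; rewrite ?addr0 ?add0r // addrC.
Qed.

Lemma homog1 : homog false (1 : A).
Proof.
set e := hcomp false (1 : A); set o := hcomp true (1 : A).
have e_o : e + o = 1 by exact: hcomp_sum.
have ee : homog false e by exact: homog_hcomp.
have oo : homog true o by exact: homog_hcomp.
have := mulr1 o; rewrite -{1}e_o mulrDr => /(congr1 (hcomp true)).
have h1 : hcomp true (o * o) = 0 by rewrite (homog_neq _ (homogM oo oo)).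
rewrite hcompD h1 addr0 (homogM oo ee) oo => oe.
have : o = 0.
  have := mul1r e; rewrite -{1}e_o mulrDl oe => /(congr1 (hcomp true)).
  rewrite hcompD (homog_neq true (homogM ee ee)) add0r oo.
  by rewrite (homog_neq _ ee).
by rewrite /homog -/e => o0; rewrite -[LHS]addr0 -o0.
Qed.

End SuperAlgebraTheory.

Arguments hcomp {k A} p x : rename.

(* Symmetric Frobenius superalgebras.  The trace is homogeneous of parity eps
   when it vanishes on the homogeneous elements of the other parity, k being
   purely even. *)

Definition lin_basis (k : comPzRingType) (M : lmodType k) (I : choiceType)
    (b : I -> M) : Prop :=
  (forall x : M, exists (s : seq I) (c : I -> k),
     x = \sum_(i <- s) c i *: b i) /\
  (forall (s : seq I) (c : I -> k), uniq s ->
     \sum_(i <- s) c i *: b i = 0 -> forall i, i \in s -> c i = 0).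

Record symFrobenius (k : comPzRingType) (A : superAlgType k)
    (eps : bool) (tr : {scalar A}) : Prop := SymFrobenius {
  frob_parity : forall p (a : A), homog p a -> p != eps -> tr a = 0;
  frob_sym : forall p q (a b : A), homog p a -> homog q b ->
    tr (a * b) = (-1) ^+ (p && q) * tr (b * a);
  frob_basis : exists (I : choiceType) (b bdual : I -> A),
    [/\ lin_basis b, lin_basis bdual
      & forall i j, tr (bdual i * b j) = (i == j)%:R] }.

(* A module whose axioms hold up to an equivalence relation, and its
   quotient by that relation, which is an [lmodType]. *)

Record setoidMod (k : comPzRingType) := SetoidMod {
  sm_car :> Type;
  sm_eq : sm_car -> sm_car -> Prop;
  sm_zero : sm_car;
  sm_add : sm_car -> sm_car -> sm_car;
  sm_scale : k -> sm_car -> sm_car;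
  sm_refl : forall x, sm_eq x x;
  sm_sym : forall x y, sm_eq x y -> sm_eq y x;
  sm_trans : forall x y z, sm_eq x y -> sm_eq y z -> sm_eq x z;
  sm_addP : forall x x' y y', sm_eq x x' -> sm_eq y y' ->
    sm_eq (sm_add x y) (sm_add x' y');
  sm_scaleP : forall c x x', sm_eq x x' -> sm_eq (sm_scale c x) (sm_scale c x');
  sm_addA : forall x y z,
    sm_eq (sm_add x (sm_add y z)) (sm_add (sm_add x y) z);
  sm_addC : forall x y, sm_eq (sm_add x y) (sm_add y x);
  sm_add0 : forall x, sm_eq (sm_add sm_zero x) x;
  sm_scaleA : forall c d x,
    sm_eq (sm_scale c (sm_scale d x)) (sm_scale (c * d) x);
  sm_scale1 : forall x, sm_eq (sm_scale 1 x) x;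
  sm_scale0 : forall x, sm_eq (sm_scale 0 x) sm_zero;
  sm_scaleDr : forall c x y,
    sm_eq (sm_scale c (sm_add x y)) (sm_add (sm_scale c x) (sm_scale c y));
  sm_scaleDl : forall c d x,
    sm_eq (sm_scale (c + d) x) (sm_add (sm_scale c x) (sm_scale d x)) }.

Section SetoidQuotient.
Variables (k : comPzRingType) (M : setoidMod k).

Definition sm_rel : rel {classic M} := fun x y => `[< sm_eq x y >].

Lemma sm_rel_refl : reflexive sm_rel.
Proof. by move=> x; apply/asboolP; apply: sm_refl. Qed.

Lemma sm_rel_sym : symmetric sm_rel.
Proof. by move=> x y; apply/asboolP/asboolP; apply: sm_sym. Qed.

Lemma sm_rel_trans : transitive sm_rel.
Proof.
by move=> y x z /asboolP xy /asboolP yz; apply/asboolP; apply: sm_trans yz.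
Qed.

Canonical sm_equiv := EquivRel sm_rel sm_rel_refl sm_rel_sym sm_rel_trans.

Definition smq : Type := {eq_quot sm_equiv}.
HB.instance Definition _ := Choice.on smq.
HB.instance Definition _ := Quotient.on smq.

Definition cls (x : M) : smq := \pi_smq (x : {classic M}).
Definition rep (x : smq) : M := repr x.

Lemma repK x : cls (rep x) = x.
Proof. exact: reprK. Qed.

Lemma clsP x y : cls x = cls y <-> sm_eq x y.
Proof.
have h : reflect (cls x = cls y) (sm_rel x y).
  exact: (@eqmodP _ sm_equiv).
by split=> [/h/asboolP //|e]; apply/h/asboolP.
Qed.

Lemma rep_cls x : sm_eq (rep (cls x)) x.
Proof. by apply/clsP; rewrite repK. Qed.

Lemma clsW (P : smq -> Prop) : (forall x, P (cls x)) -> forall x, P x.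
Proof. by move=> h x; rewrite -(repK x). Qed.

Definition smq_add (x y : smq) : smq := cls (sm_add (rep x) (rep y)).
Definition smq_scale (c : k) (x : smq) : smq := cls (sm_scale c (rep x)).
Definition smq_opp (x : smq) : smq := smq_scale (-1) x.

Lemma smq_addE x y : smq_add (cls x) (cls y) = cls (sm_add x y).
Proof. by apply/clsP/sm_addP; apply: rep_cls. Qed.

Lemma smq_scaleE c x : smq_scale c (cls x) = cls (sm_scale c x).
Proof. by apply/clsP/sm_scaleP; apply: rep_cls. Qed.

Lemma smq_addA : associative smq_add.
Proof.
elim/clsW=> x; elim/clsW=> y; elim/clsW=> z.
by rewrite !smq_addE; apply/clsP/sm_addA.
Qed.

Lemma smq_addC : commutative smq_add.
Proof. by elim/clsW=> x; elim/clsW=> y; rewrite !smq_addE; apply/clsP/sm_addC. Qed.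

Lemma smq_add0 : left_id (cls (sm_zero M)) smq_add.
Proof. by elim/clsW=> x; rewrite !smq_addE; apply/clsP/sm_add0. Qed.

Lemma smq_addN : left_inverse (cls (sm_zero M)) smq_opp smq_add.
Proof.
elim/clsW=> x; rewrite /smq_opp smq_scaleE smq_addE; apply/clsP.
apply: (sm_trans (y := sm_scale 0 x)); last exact: sm_scale0.
rewrite -(addNr 1); apply: sm_sym; apply: (sm_trans (sm_scaleDl _ _ _)).
by apply: sm_addP; [apply: sm_refl | apply: sm_scale1].
Qed.

HB.instance Definition _ :=
  GRing.isZmodule.Build smq smq_addA smq_addC smq_add0 smq_addN.

Lemma smq_scaleA c d x : smq_scale c (smq_scale d x) = smq_scale (c * d) x.
Proof. by elim/clsW: x => x; rewrite !smq_scaleE; apply/clsP/sm_scaleA. Qed.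

Lemma smq_scale1 : left_id 1 smq_scale.
Proof. by elim/clsW=> x; rewrite !smq_scaleE; apply/clsP/sm_scale1. Qed.

Lemma smq_scaleDr : right_distributive smq_scale +%R.
Proof.
move=> c; elim/clsW=> x; elim/clsW=> y; rewrite /GRing.add /=.
by rewrite !(smq_scaleE, smq_addE); apply/clsP/sm_scaleDr.
Qed.

Lemma smq_scaleDl x : {morph smq_scale^~ x : c d / c + d}.
Proof.
elim/clsW: x => x c d; rewrite [in RHS]/GRing.add /=.
by rewrite !(smq_scaleE, smq_addE); apply/clsP/sm_scaleDl.
Qed.

HB.instance Definition _ := GRing.Zmodule_isLmodule.Build k smq
  smq_scaleA smq_scale1 smq_scaleDr smq_scaleDl.

Lemma clsD x y : cls (sm_add x y) = cls x + cls y.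
Proof. by rewrite -smq_addE. Qed.

Lemma clsZ c x : cls (sm_scale c x) = c *: cls x.
Proof. by rewrite -smq_scaleE. Qed.

Lemma cls0 : cls (sm_zero M) = 0.
Proof. by []. Qed.

End SetoidQuotient.

Section BaseSuperAlgebra.
Variable k : comPzRingType.

Definition baseSA : Type := k^o.
HB.instance Definition _ := GRing.Lmodule.on baseSA.

Definition base_hcomp (p : bool) (x : baseSA) : baseSA := if p then 0 else x.

Lemma base_smulA : associative (fun x y : baseSA => (x : k) * (y : k)).
Proof. by move=> x y z; rewrite mulrA. Qed.
Lemma base_mul1x : left_id (1 : k) (fun x y : baseSA => (x : k) * (y : k)).
Proof. by move=> x; rewrite mul1r. Qed.
Lemma base_mulx1 : right_id (1 : k) (fun x y : baseSA => (x : k) * (y : k)).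
Proof. by move=> x; rewrite mulr1. Qed.
Lemma base_mulDl :
  left_distributive (fun x y : baseSA => (x : k) * (y : k)) +%R.
Proof. by move=> x y z; apply: mulrDl. Qed.
Lemma base_mulDr :
  right_distributive (fun x y : baseSA => (x : k) * (y : k)) +%R.
Proof. by move=> x y z; apply: mulrDr. Qed.
Lemma base_mulZl (c : k) (x y : baseSA) :
  ((c *: x : baseSA) : k) * (y : k) = c *: ((x : k) * (y : k) : baseSA).
Proof. by rewrite /GRing.scale /= mulrA. Qed.
Lemma base_mulZr (c : k) (x y : baseSA) :
  (x : k) * ((c *: y : baseSA) : k) = c *: ((x : k) * (y : k) : baseSA).
Proof. by rewrite /GRing.scale /= mulrCA. Qed.
Lemma base_hcompD p : {morph base_hcomp p : x y / x + y}.
Proof. by case: p => x y //=; rewrite addr0. Qed.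
Lemma base_hcompZ p (c : k) : {morph base_hcomp p : x / c *: x}.
Proof. by case: p => x //=; rewrite scaler0. Qed.
Lemma base_hcomp_sum x : base_hcomp false x + base_hcomp true x = x.
Proof. exact: addr0. Qed.
Lemma base_hcompK p q x :
  base_hcomp p (base_hcomp q x) = if p == q then base_hcomp q x else 0.
Proof. by case: p q => [] []. Qed.
Lemma base_hcompM p q (x y : baseSA) :
  base_hcomp (p (+) q) ((base_hcomp p x : k) * (base_hcomp q y : k)) =
  (base_hcomp p x : k) * (base_hcomp q y : k).
Proof. by case: p q => [] [] //=; rewrite ?(mul0r, mulr0). Qed.

HB.instance Definition _ := Lmodule_isSuperAlgebra.Build k baseSA
  base_smulA base_mul1x base_mulx1 base_mulDl base_mulDr base_mulZl base_mulZr
  base_hcompD base_hcompZ base_hcomp_sum base_hcompK base_hcompM.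
HB.instance Definition _ :=
  GRing.PzRing.copy baseSA (SuperAlgebra.sort baseSA).

End BaseSuperAlgebra.

(* The tensor product A (x) B of k-modules: formal linear combinations of
   symbols a (x) b modulo the congruence generated by the module axioms and
   bilinearity. *)
Section TensorModule.
Variables (k : comPzRingType) (A B : lmodType k).

Inductive tens_term : Type :=
| TPure of A & B
| TZero
| TAdd of tens_term & tens_term
| TScale of k & tens_term.

Inductive tens_eq : tens_term -> tens_term -> Prop :=
| te_refl x : tens_eq x x
| te_sym x y : tens_eq x y -> tens_eq y x
| te_trans x y z : tens_eq x y -> tens_eq y z -> tens_eq x z
| te_add x x' y y' : tens_eq x x' -> tens_eq y y' ->
    tens_eq (TAdd x y) (TAdd x' y')
| te_scale c x x' : tens_eq x x' -> tens_eq (TScale c x) (TScale c x')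
| te_addA x y z : tens_eq (TAdd x (TAdd y z)) (TAdd (TAdd x y) z)
| te_addC x y : tens_eq (TAdd x y) (TAdd y x)
| te_add0 x : tens_eq (TAdd TZero x) x
| te_scaleA c d x : tens_eq (TScale c (TScale d x)) (TScale (c * d) x)
| te_scale1 x : tens_eq (TScale 1 x) x
| te_scale0 x : tens_eq (TScale 0 x) TZero
| te_scaleDr c x y :
    tens_eq (TScale c (TAdd x y)) (TAdd (TScale c x) (TScale c y))
| te_scaleDl c d x : tens_eq (TScale (c + d) x) (TAdd (TScale c x) (TScale d x))
| te_pureDl a a' b :
    tens_eq (TPure (a + a') b) (TAdd (TPure a b) (TPure a' b))
| te_pureDr a b b' :
    tens_eq (TPure a (b + b')) (TAdd (TPure a b) (TPure a b'))
| te_pureZl c a b : tens_eq (TPure (c *: a) b) (TScale c (TPure a b))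
| te_pureZr c a b : tens_eq (TPure a (c *: b)) (TScale c (TPure a b)).

Definition tens_setoid : setoidMod k := SetoidMod te_refl te_sym te_trans
  te_add te_scale te_addA te_addC te_add0 te_scaleA te_scale1 te_scale0
  te_scaleDr te_scaleDl.

Definition tensor : Type := smq tens_setoid.
HB.instance Definition _ := GRing.Lmodule.on tensor.

Definition tpure (a : A) (b : B) : tensor := @cls k tens_setoid (TPure a b).

Lemma tpureDl a a' b : tpure (a + a') b = tpure a b + tpure a' b.
Proof. by rewrite -[RHS](clsD (M := tens_setoid)); apply/clsP/te_pureDl. Qed.
Lemma tpureDr a b b' : tpure a (b + b') = tpure a b + tpure a b'.
Proof. by rewrite -[RHS](clsD (M := tens_setoid)); apply/clsP/te_pureDr. Qed.
Lemma tpureZl c a b : tpure (c *: a) b = c *: tpure a b.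
Proof. by rewrite -[RHS](clsZ (M := tens_setoid)); apply/clsP/te_pureZl. Qed.
Lemma tpureZr c a b : tpure a (c *: b) = c *: tpure a b.
Proof. by rewrite -[RHS](clsZ (M := tens_setoid)); apply/clsP/te_pureZr. Qed.

Lemma tens_ind' (P : tensor -> Prop) :
  (forall a b, P (tpure a b)) -> P 0 ->
  (forall x y, P x -> P y -> P (x + y)) ->
  (forall c x, P x -> P (c *: x)) -> forall x, P x.
Proof.
move=> h1 h2 h3 h4; apply: (clsW (M := tens_setoid)).
elim=> [a b||x hx y hy|c x hx].
- exact: h1.
- exact: h2.
- by rewrite (clsD (M := tens_setoid)); apply: h3.
- by rewrite (clsZ (M := tens_setoid)); apply: h4.
Qed.

End TensorModule.
Arguments tpure {k A B} a b.

Record is_bilin (k : comPzRingType) (A B V : lmodType k) (f : A -> B -> V) :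
    Prop := IsBilin {
  bilDl : forall a a' b, f (a + a') b = f a b + f a' b;
  bilDr : forall a b b', f a (b + b') = f a b + f a b';
  bilZl : forall c a b, f (c *: a) b = c *: f a b;
  bilZr : forall c a b, f a (c *: b) = c *: f a b }.

(* For f bilinear, [tlift f] is the linear map a (x) b |-> f a b. *)
Section TensorLift.
Variables (k : comPzRingType) (A B V : lmodType k).

Fixpoint tval (f : A -> B -> V) (t : tens_term A B) : V :=
  match t with
  | TPure a b => f a b
  | TZero => 0
  | TAdd x y => tval f x + tval f y
  | TScale c x => c *: tval f x
  end.

Definition tlift (f : A -> B -> V) (x : tensor A B) : V :=
  tval f (rep (M := tens_setoid A B) x).

Variable (f : A -> B -> V).
Hypothesis fbil : is_bilin f.

Lemma tvalP t t' : tens_eq t t' -> tval f t = tval f t'.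
Proof.
elim=> //=.
- by move=> x y z _ -> _ ->.
- by move=> x x' y y' _ -> _ ->.
- by move=> c x x' _ ->.
- by move=> *; rewrite addrA.
- by move=> *; rewrite addrC.
- by move=> *; rewrite add0r.
- by move=> *; rewrite scalerA.
- by move=> *; rewrite scale1r.
- by move=> *; rewrite scale0r.
- by move=> *; rewrite scalerDr.
- by move=> *; rewrite scalerDl.
- exact: bilDl.
- exact: bilDr.
- exact: bilZl.
- exact: bilZr.
Qed.

Lemma tlift_cls t : tlift f (cls (M := tens_setoid A B) t) = tval f t.
Proof. exact/tvalP/(rep_cls (M := tens_setoid A B)). Qed.

Lemma tlift_pure a b : tlift f (tpure a b) = f a b.
Proof. exact: tlift_cls. Qed.

Lemma tliftD : {morph tlift f : x y / x + y}.
Proof.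
elim/(clsW (M := tens_setoid A B)) => x.
elim/(clsW (M := tens_setoid A B)) => y.
by rewrite -[_ + _](clsD (M := tens_setoid A B)) !tlift_cls.
Qed.

Lemma tliftZ c : {morph tlift f : x / c *: x}.
Proof.
elim/(clsW (M := tens_setoid A B)) => x.
by rewrite -[_ *: _](clsZ (M := tens_setoid A B)) !tlift_cls.
Qed.

Lemma tlift0 : tlift f 0 = 0.
Proof. by rewrite -(scale0r 0) tliftZ scale0r. Qed.

End TensorLift.

Lemma eq_tlift (k : comPzRingType) (A B V : lmodType k) (f g : A -> B -> V) :
  (forall a b, f a b = g a b) -> tlift f =1 tlift g.
Proof.
move=> fg x; rewrite /tlift; elim: (rep _) => //= [x1 -> x2 -> //|c y -> //].
Qed.

(* The tensor product of superalgebras, with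
   (a' (x) b)(a (x) b') = (-1)^(|a||b|) a'a (x) bb' for a, b homogeneous. *)
Section TensorSuperAlgebra.
Variables (k : comPzRingType) (A B : superAlgType k).
Local Notation T := (tensor A B).

Definition sgn (p q : bool) : k := (-1) ^+ (p && q).

Definition tmul_pure (a' : A) (b : B) (a : A) (b' : B) : T :=
  \sum_(p : bool) \sum_(q : bool)
    sgn p q *: tpure (a' * hcomp p a) (hcomp q b * b').

Definition tmul (x y : T) : T :=
  tlift (fun a' b => tlift (tmul_pure a' b) y) x.

Definition tone : T := tpure (1 : A) (1 : B).

Definition thcomp (p : bool) : T -> T :=
  tlift (fun a b => \sum_(q : bool) tpure (hcomp q a) (hcomp (p (+) q) b)).

Lemma sum_bool (V : zmodType) (F : bool -> V) :
  \sum_(p : bool) F p = F false + F true.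
Proof. by rewrite big_bool addrC. Qed.

Lemma tmul_pure_bil a' b : is_bilin (tmul_pure a' b).
Proof.
split=> *; rewrite /tmul_pure -?scaler_sumr.
- rewrite -big_split; apply: eq_bigr => p _; rewrite -big_split.
  by apply: eq_bigr => q _; rewrite hcompD mulrDr tpureDl scalerDr.
- rewrite -big_split; apply: eq_bigr => p _; rewrite -big_split.
  by apply: eq_bigr => q _; rewrite mulrDr tpureDr scalerDr.
- rewrite scaler_sumr; apply: eq_bigr => p _; rewrite scaler_sumr.
  by apply: eq_bigr => q _; rewrite hcompZ superAr tpureZl !scalerA mulrC.
- rewrite scaler_sumr; apply: eq_bigr => p _; rewrite scaler_sumr.
  by apply: eq_bigr => q _; rewrite superAr tpureZr !scalerA mulrC.
Qed.

Lemma tmul_pure_bil2 a b' : is_bilin (fun a' b => tmul_pure a' b a b').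
Proof.
split=> *; rewrite /tmul_pure.
- rewrite -big_split; apply: eq_bigr => p _; rewrite -big_split.
  by apply: eq_bigr => q _; rewrite mulrDl tpureDl scalerDr.
- rewrite -big_split; apply: eq_bigr => p _; rewrite -big_split.
  by apply: eq_bigr => q _; rewrite hcompD mulrDl tpureDr scalerDr.
- rewrite scaler_sumr; apply: eq_bigr => p _; rewrite scaler_sumr.
  by apply: eq_bigr => q _; rewrite superAl tpureZl !scalerA mulrC.
- rewrite scaler_sumr; apply: eq_bigr => p _; rewrite scaler_sumr.
  by apply: eq_bigr => q _; rewrite hcompZ superAl tpureZr !scalerA mulrC.
Qed.

Lemma tmul_bil y : is_bilin (fun a' b => tlift (tmul_pure a' b) y).
Proof.
have L a' b := tliftD (tmul_pure_bil a' b).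
have LZ a' b := tliftZ (tmul_pure_bil a' b).
have L0 a' b := tlift0 (tmul_pure_bil a' b).
have LP a' b := tlift_pure (tmul_pure_bil a' b).
split=> *; elim/tens_ind': y => [a2 b2||x y hx hy|d x hx];
  rewrite ?LP ?L0 ?L ?LZ ?addr0 ?scaler0 //.
- exact: (bilDl (tmul_pure_bil2 _ _)).
- by rewrite hx hy addrACA.
- by rewrite hx scalerDr.
- exact: (bilDr (tmul_pure_bil2 _ _)).
- by rewrite hx hy addrACA.
- by rewrite hx scalerDr.
- exact: (bilZl (tmul_pure_bil2 _ _)).
- by rewrite hx hy scalerDr.
- by rewrite hx !scalerA mulrC.
- exact: (bilZr (tmul_pure_bil2 _ _)).
- by rewrite hx hy scalerDr.
- by rewrite hx !scalerA mulrC.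
Qed.

Lemma tmulDl : left_distributive tmul +%R.
Proof. by move=> x y z; apply: (tliftD (tmul_bil z)). Qed.

Lemma tmulZl c x y : tmul (c *: x) y = c *: tmul x y.
Proof. exact: (tliftZ (tmul_bil y)). Qed.

Lemma tmul_tpure a b y : tmul (tpure a b) y = tlift (tmul_pure a b) y.
Proof. exact: (tlift_pure (tmul_bil y)). Qed.

Lemma tmul0l y : tmul 0 y = 0.
Proof. exact: (tlift0 (tmul_bil y)). Qed.

Lemma tmulDr : right_distributive tmul +%R.
Proof.
move=> x y z; elim/tens_ind': x => [a b||x x' hx hx'|c x hx].
- by rewrite !tmul_tpure (tliftD (tmul_pure_bil a b)).
- by rewrite !tmul0l addr0.
- by rewrite !tmulDl hx hx' addrACA.
- by rewrite !tmulZl hx scalerDr.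
Qed.

Lemma tmulZr c x y : tmul x (c *: y) = c *: tmul x y.
Proof.
elim/tens_ind': x => [a b||x x' hx hx'|d x hx].
- by rewrite !tmul_tpure (tliftZ (tmul_pure_bil a b)).
- by rewrite !tmul0l scaler0.
- by rewrite !tmulDl hx hx' scalerDr.
- by rewrite !tmulZl hx !scalerA mulrC.
Qed.

Lemma tmul0r x : tmul x 0 = 0.
Proof. by rewrite -(scale0r 0) tmulZr !scale0r. Qed.

Lemma tpure0l (b : B) : tpure (0 : A) b = 0.
Proof. by rewrite -(scale0r (0 : A)) tpureZl scale0r. Qed.
Lemma tpure0r (a : A) : tpure a (0 : B) = 0.
Proof. by rewrite -(scale0r (0 : B)) tpureZr scale0r. Qed.

Lemma tmulE p q a' b a b' : homog p a -> homog q b ->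
  tmul (tpure a' b) (tpure a b') = sgn p q *: tpure (a' * a) (b * b').
Proof.
move=> ha hb; rewrite tmul_tpure (tlift_pure (tmul_pure_bil _ _)) /tmul_pure.
rewrite !sum_bool !(homog_neq _ ha) !(homog_neq _ hb).
by case: p q {ha hb} => [] [];
  rewrite /= !(mulr0, mul0r, tpure0l, tpure0r, scaler0, addr0, add0r).
Qed.

Lemma tens_indh (P : T -> Prop) :
  (forall p q a b, homog p a -> homog q b -> P (tpure a b)) -> P 0 ->
  (forall x y, P x -> P y -> P (x + y)) ->
  (forall c x, P x -> P (c *: x)) -> forall x, P x.
Proof.
move=> h1 h2 h3 h4; apply: tens_ind' => // a b.
rewrite -[a]hcomp_sum -[b]hcomp_sum tpureDl !tpureDr.
by apply: (h3); apply: h3; apply: h1; apply: homog_hcomp.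
Qed.

Lemma tmulA : associative tmul.
Proof.
elim/tens_indh => [p1 q1 a1 b1 ha1 hb1||x x' hx hx'|c x hx] y z.
- elim/tens_indh: y z => [p2 q2 a2 b2 ha2 hb2||y y' hy hy'|c y hy] z.
  + elim/tens_indh: z => [p3 q3 a3 b3 ha3 hb3||z z' hz hz'|c z hz].
    * rewrite (tmulE _ _ ha3 hb2) (tmulE _ _ ha2 hb1) tmulZr tmulZl.
      rewrite (tmulE _ _ (homogM ha2 ha3) hb1) (tmulE _ _ ha3 (homogM hb1 hb2)).
      rewrite !scalerA !mulrA; congr (_ *: _).
      by case: p2 p3 q1 q2 {ha2 ha3 hb1 hb2} => [] [] [] [];
        rewrite /sgn /= ?expr1 ?expr0 ?mulr1 ?mul1r ?mulN1r ?opprK.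
    * by rewrite !tmul0r.
    * by rewrite !tmulDr hz hz'.
    * by rewrite !tmulZr hz.
  + by rewrite !(tmul0r, tmul0l).
  + by rewrite !(tmulDr, tmulDl) hy hy'.
  + by rewrite !(tmulZr, tmulZl) hy.
- by rewrite !tmul0l.
- by rewrite !tmulDl hx hx'.
- by rewrite !tmulZl hx.
Qed.

Lemma tmul1x : left_id tone tmul.
Proof.
elim/tens_indh => [p q a b ha hb||x x' hx hx'|c x hx].
- by rewrite (tmulE _ _ ha (homog1 B)) !mul1r /sgn andbF scale1r.
- exact: tmul0r.
- by rewrite tmulDr hx hx'.
- by rewrite tmulZr hx.
Qed.

Lemma tmulx1 : right_id tone tmul.
Proof.
elim/tens_indh => [p q a b ha hb||x x' hx hx'|c x hx].
- by rewrite (tmulE _ _ (homog1 A) hb) !mulr1 /sgn scale1r.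
- exact: tmul0l.
- by rewrite tmulDl hx hx'.
- by rewrite tmulZl hx.
Qed.

Lemma thcomp_bil p : is_bilin
  (fun (a : A) (b : B) => \sum_(q : bool) tpure (hcomp q a) (hcomp (p (+) q) b)).
Proof.
split=> *; rewrite ?scaler_sumr -?big_split; apply: eq_bigr => q _;
  by rewrite ?(hcompD, hcompZ) ?(tpureDl, tpureDr, tpureZl, tpureZr).
Qed.

Lemma thcompD p : {morph thcomp p : x y / x + y}.
Proof. exact: (tliftD (thcomp_bil p)). Qed.

Lemma thcompZ p (c : k) : {morph thcomp p : x / c *: x}.
Proof. exact: (tliftZ (thcomp_bil p)). Qed.

Lemma thcomp0 p : thcomp p 0 = 0.
Proof. exact: (tlift0 (thcomp_bil p)). Qed.

Lemma thcompE r p q a b : homog p a -> homog q b ->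
  thcomp r (tpure a b) = if r == p (+) q then tpure a b else 0.
Proof.
move=> ha hb; rewrite /thcomp (tlift_pure (thcomp_bil r)) sum_bool.
rewrite !(homog_neq _ ha) !(homog_neq _ hb).
by case: p q r {ha hb} => [] [] [];
  rewrite /= ?tpure0l ?tpure0r ?addr0 ?add0r.
Qed.

Lemma thcomp_sum x : thcomp false x + thcomp true x = x.
Proof.
elim/tens_indh: x => [p q a b ha hb||x y hx hy|c x hx].
- rewrite !(thcompE _ ha hb).
  by case: (p (+) q); rewrite /= ?addr0 ?add0r.
- by rewrite !thcomp0 addr0.
- by rewrite !thcompD addrACA hx hy.
- by rewrite !thcompZ -scalerDr hx.
Qed.

Lemma thcompK p q x :
  thcomp p (thcomp q x) = if p == q then thcomp q x else 0.
Proof.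
elim/tens_indh: x => [p' q' a b ha hb||x y hx hy|c x hx].
- rewrite !(thcompE _ ha hb); case: eqP => [->|_].
    by rewrite (thcompE _ ha hb).
  by rewrite thcomp0 if_same.
- by rewrite !thcomp0 if_same.
- by rewrite !thcompD hx hy; case: ifP; rewrite ?addr0.
- by rewrite !thcompZ hx; case: ifP; rewrite ?scaler0.
Qed.

Lemma thcompM p q x y :
  thcomp (p (+) q) (tmul (thcomp p x) (thcomp q y)) =
  tmul (thcomp p x) (thcomp q y).
Proof.
elim/tens_indh: x => [p1 q1 a1 b1 ha1 hb1||x x' hx hx'|c x hx].
- elim/tens_indh: y => [p2 q2 a2 b2 ha2 hb2||y y' hy hy'|c y hy].
  + rewrite !(thcompE _ ha1 hb1) !(thcompE _ ha2 hb2).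
    case: eqP => [->|_]; last by rewrite tmul0l thcomp0.
    case: eqP => [->|_]; last by rewrite tmul0r thcomp0.
    rewrite (tmulE _ _ ha2 hb1) thcompZ.
    rewrite (thcompE _ (homogM ha1 ha2) (homogM hb1 hb2)).
    by rewrite addbACA eqxx.
  + by rewrite !(thcomp0, tmul0r).
  + by rewrite !(thcompD, tmulDr) hy hy'.
  + by rewrite !(thcompZ, tmulZr) hy.
- by rewrite !(thcomp0, tmul0l).
- by rewrite !(thcompD, tmulDl) hx hx'.
- by rewrite !(thcompZ, tmulZl) hx.
Qed.

HB.instance Definition _ := Lmodule_isSuperAlgebra.Build k (tensor A B)
  tmulA tmul1x tmulx1 tmulDl tmulDr tmulZl tmulZr
  thcompD thcompZ thcomp_sum thcompK thcompM.
HB.instance Definition _ :=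
  GRing.PzRing.copy (tensor A B) (SuperAlgebra.sort (tensor A B)).

End TensorSuperAlgebra.

(* Tensor powers.  The leftmost factor of A^(x)(m+1) = A (x) A^(x)m has the
   largest number; strands are numbered from right to left, starting at 0, so
   that strand i here is strand i+1 of the usual 1-based numbering. *)
Section TensorPower.
Variables (k : comPzRingType) (A : superAlgType k).

Fixpoint tpow (n : nat) : superAlgType k :=
  match n with
  | 0 => baseSA k
  | m.+1 => tensor A (tpow m)
  end.

(* 1 (x) ... (x) a (x) ... (x) 1, with a in factor i. *)
Fixpoint tpow_at (n i : nat) (a : A) : tpow n :=
  match n return tpow n with
  | 0 => 1
  | m.+1 => if i == m then tpure a (1 : tpow m) else tpure (1 : A) (tpow_at m i a)
  end.

(* a (x) (b (x) m) |-> (-1)^(|a||b|) b (x) (a (x) m) *)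
Definition tswap (M : lmodType k) : tensor A (tensor A M) -> tensor A (tensor A M) :=
  tlift (fun a => tlift (fun b m =>
    \sum_(p : bool) \sum_(q : bool)
      sgn k p q *: tpure (hcomp q b) (tpure (hcomp p a) m))).

(* id (x) f *)
Definition tmapr (M N : lmodType k) (f : M -> N) : tensor A M -> tensor A N :=
  tlift (fun a m => tpure a (f m)).

(* The simple transposition of the factors i and i+1 (numbered from 0). *)
Fixpoint sact (n i : nat) : tpow n -> tpow n :=
  match n return tpow n -> tpow n with
  | 0 => id
  | m.+1 =>
    match m return (tpow m -> tpow m) -> tpow m.+1 -> tpow m.+1 with
    | 0 => fun _ => id
    | l.+1 => fun f => if i == l then @tswap (tpow l) else tmapr f
    end (@sact m i)
  end.

End TensorPower.
Arguments tpow {k} A n.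
Arguments tpow_at {k A} n i a.
Arguments sact {k A} n i x.

(* The free superalgebra on a set G of generators with parity par: terms
   modulo the congruence generated by the k-algebra axioms. *)
Section FreeSuperAlgebra.
Variables (k : comPzRingType) (G : Type) (par : G -> bool).

Inductive free_term : Type :=
| FGen of G
| FScal of k
| FAdd of free_term & free_term
| FMul of free_term & free_term.

Inductive free_eq : free_term -> free_term -> Prop :=
| fe_refl x : free_eq x x
| fe_sym x y : free_eq x y -> free_eq y x
| fe_trans x y z : free_eq x y -> free_eq y z -> free_eq x z
| fe_add x x' y y' : free_eq x x' -> free_eq y y' ->
    free_eq (FAdd x y) (FAdd x' y')
| fe_mul x x' y y' : free_eq x x' -> free_eq y y' ->
    free_eq (FMul x y) (FMul x' y')
| fe_addA x y z : free_eq (FAdd x (FAdd y z)) (FAdd (FAdd x y) z)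
| fe_addC x y : free_eq (FAdd x y) (FAdd y x)
| fe_add0 x : free_eq (FAdd (FScal 0) x) x
| fe_mulA x y z : free_eq (FMul x (FMul y z)) (FMul (FMul x y) z)
| fe_mul1x x : free_eq (FMul (FScal 1) x) x
| fe_mulx1 x : free_eq (FMul x (FScal 1)) x
| fe_mul0x x : free_eq (FMul (FScal 0) x) (FScal 0)
| fe_mulDl x y z : free_eq (FMul (FAdd x y) z) (FAdd (FMul x z) (FMul y z))
| fe_mulDr x y z : free_eq (FMul x (FAdd y z)) (FAdd (FMul x y) (FMul x z))
| fe_scalD c d : free_eq (FScal (c + d)) (FAdd (FScal c) (FScal d))
| fe_scalM c d : free_eq (FScal (c * d)) (FMul (FScal c) (FScal d))
| fe_scalC c x : free_eq (FMul (FScal c) x) (FMul x (FScal c)).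

Let fscale c x := FMul (FScal c) x.

Lemma fe_scaleP c x x' : free_eq x x' -> free_eq (fscale c x) (fscale c x').
Proof. by move=> h; apply: fe_mul => //; apply: fe_refl. Qed.

Lemma fe_scaleA c d x : free_eq (fscale c (fscale d x)) (fscale (c * d) x).
Proof.
apply: (fe_trans (fe_mulA _ _ _)); apply: fe_mul; last exact: fe_refl.
exact/fe_sym/fe_scalM.
Qed.

Lemma fe_scaleDl c d x :
  free_eq (fscale (c + d) x) (FAdd (fscale c x) (fscale d x)).
Proof.
apply: fe_trans (fe_mulDl _ _ _); apply: fe_mul; last exact: fe_refl.
exact: fe_scalD.
Qed.

Definition free_setoid : setoidMod k := SetoidMod fe_refl fe_sym fe_trans
  fe_add fe_scaleP fe_addA fe_addC fe_add0 fe_scaleA fe_mul1x fe_mul0x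
  (fun c => fe_mulDr (FScal c)) fe_scaleDl.

(* par only selects the grading. *)
Definition freeSA of G -> bool : Type := smq free_setoid.
Local Notation F := (freeSA par).
HB.instance Definition _ := GRing.Lmodule.on F.
Local Notation fcls := (@cls k free_setoid : free_term -> F).
Local Notation frep := (@rep k free_setoid : F -> free_term).

Definition fgen (g : G) : F := fcls (FGen g).
Definition fone : F := fcls (FScal 1).
Definition fmul (x y : F) : F := fcls (FMul (frep x) (frep y)).

Lemma fmulE x y : fmul (fcls x) (fcls y) = fcls (FMul x y).
Proof. by apply/clsP/fe_mul; apply: (rep_cls (M := free_setoid)). Qed.

Lemma fclsD x y : fcls (FAdd x y) = fcls x + fcls y.
Proof. exact: (clsD (M := free_setoid)). Qed.

Lemma fclsZ c x : fcls (FMul (FScal c) x) = c *: fcls x.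
Proof. exact: (clsZ (M := free_setoid)). Qed.

Lemma fclsP x y : fcls x = fcls y <-> free_eq x y.
Proof. exact: (clsP (M := free_setoid)). Qed.

Lemma fclsW (P : F -> Prop) : (forall x, P (fcls x)) -> forall x, P x.
Proof. exact: (clsW (M := free_setoid)). Qed.

Lemma fmulA : associative fmul.
Proof.
elim/fclsW=> x; elim/fclsW=> y; elim/fclsW=> z.
by rewrite !fmulE; apply/fclsP/fe_mulA.
Qed.

Lemma fmul1x : left_id fone fmul.
Proof. by elim/fclsW=> x; rewrite fmulE; apply/fclsP/fe_mul1x. Qed.

Lemma fmulx1 : right_id fone fmul.
Proof. by elim/fclsW=> x; rewrite fmulE; apply/fclsP/fe_mulx1. Qed.

Lemma fmulDl : left_distributive fmul +%R.
Proof.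
elim/fclsW=> x; elim/fclsW=> y; elim/fclsW=> z.
by rewrite -fclsD !fmulE -fclsD; apply/fclsP/fe_mulDl.
Qed.

Lemma fmulDr : right_distributive fmul +%R.
Proof.
elim/fclsW=> x; elim/fclsW=> y; elim/fclsW=> z.
by rewrite -fclsD !fmulE -fclsD; apply/fclsP/fe_mulDr.
Qed.

Lemma fmulZl c x y : fmul (c *: x) y = c *: fmul x y.
Proof.
elim/fclsW: x => x; elim/fclsW: y => y.
by rewrite -fclsZ !fmulE -fclsZ; apply/fclsP/fe_sym/fe_mulA.
Qed.

Lemma fmulZr c x y : fmul x (c *: y) = c *: fmul x y.
Proof.
elim/fclsW: x => x; elim/fclsW: y => y.
rewrite -fclsZ !fmulE -fclsZ; apply/fclsP.
apply: (fe_trans (fe_mulA _ _ _)); apply: fe_trans (fe_sym (fe_mulA _ _ _)).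
by apply: fe_mul; [apply/fe_sym/fe_scalC | apply: fe_refl].
Qed.

Lemma fmul0x x : fmul 0 x = 0.
Proof. by rewrite -(scale0r (0 : F)) fmulZl !scale0r. Qed.

Lemma fmulx0 x : fmul x 0 = 0.
Proof. by rewrite -(scale0r (0 : F)) fmulZr !scale0r. Qed.

Fixpoint fproj (p : bool) (t : free_term) : F :=
  match t with
  | FGen g => if p == par g then fgen g else 0
  | FScal c => if p then 0 else fcls (FScal c)
  | FAdd x y => fproj p x + fproj p y
  | FMul x y => fmul (fproj false x) (fproj p y) +
                fmul (fproj true x) (fproj (~~ p) y)
  end.

Lemma fscal0 : fcls (FScal 0) = 0. Proof. by []. Qed.

Lemma fprojP t t' : free_eq t t' -> forall p, fproj p t = fproj p t'.
Proof.
elim=> /=.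
- by [].
- by [].
- by move=> x y z _ h _ h' p; rewrite h h'.
- by move=> x x' y y' _ h _ h' p; rewrite h h'.
- by move=> x x' y y' _ h _ h' p; rewrite !h !h'.
- by move=> *; rewrite addrA.
- by move=> *; rewrite addrC.
- by move=> x [] ; rewrite ?fscal0 add0r.
- move=> x y z p; rewrite !(fmulDl, fmulDr) !fmulA negbK -!addrA; congr (_ + _).
  by rewrite addrC -addrA addrC -addrA; congr (_ + _); rewrite addrC.
- by move=> x p; rewrite fmul0x addr0 fmul1x.
- by move=> x []; rewrite ?fmulx0 ?addr0 ?add0r fmulx1.
- by move=> x p; rewrite fscal0 !fmul0x addr0; case: p.
- by move=> *; rewrite !fmulDl addrACA.
- by move=> *; rewrite !fmulDr addrACA.
- move=> c d []; first by rewrite addr0.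
  by rewrite -fclsD; apply/fclsP/fe_scalD.
- move=> c d []; rewrite ?(fmulx0, fmul0x, addr0) //.
  by rewrite fmulE; apply/fclsP/fe_scalM.
- move=> c x p; rewrite fmul0x addr0.
  have C y : fmul (fcls (FScal c)) y = fmul y (fcls (FScal c)).
    by elim/fclsW: y => y; rewrite !fmulE; apply/fclsP/fe_scalC.
  by rewrite C; case: p; rewrite ?fmulx0 ?addr0 ?add0r.
Qed.

Definition fhcomp (p : bool) (x : F) : F := fproj p (frep x).

Lemma fhcompE p t : fhcomp p (fcls t) = fproj p t.
Proof. exact/fprojP/(rep_cls (M := free_setoid)). Qed.

Lemma fhcompD p : {morph fhcomp p : x y / x + y}.
Proof. by elim/fclsW=> x; elim/fclsW=> y; rewrite -fclsD !fhcompE. Qed.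

Lemma fhcompM p x y : fhcomp p (fmul x y) =
  fmul (fhcomp false x) (fhcomp p y) + fmul (fhcomp true x) (fhcomp (~~ p) y).
Proof. by elim/fclsW: x => x; elim/fclsW: y => y; rewrite fmulE !fhcompE. Qed.

Lemma fhcompZ p (c : k) : {morph fhcomp p : x / c *: x}.
Proof.
elim/fclsW=> x; rewrite -fclsZ fhcompE /= -fhcompE fmul0x addr0.
by elim/fclsW: (fhcomp p _) => y; rewrite fmulE fclsZ.
Qed.

Lemma fhcomp0 p : fhcomp p 0 = 0.
Proof. by rewrite -(scale0r (0 : F)) fhcompZ !scale0r. Qed.

Lemma fhcomp_sum x : fhcomp false x + fhcomp true x = x.
Proof.
elim/fclsW: x => t; rewrite !fhcompE.
elim: t => [g|c|x hx y hy|x hx y hy] /=.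
- by case: (par g); rewrite /= ?addr0 ?add0r.
- exact: addr0.
- by rewrite addrACA hx hy fclsD.
- rewrite -fmulE -hx -hy !(fmulDl, fmulDr) -!addrA; congr (_ + _).
  by rewrite addrC addrA.
Qed.

Lemma fhcompK p q x : fhcomp p (fhcomp q x) = if p == q then fhcomp q x else 0.
Proof.
elim/fclsW: x => t; rewrite !fhcompE.
elim: t p q => [g|c|x hx y hy|x hx y hy] p q /=.
- case: eqP => [->|_]; last by rewrite fhcomp0 if_same.
  by rewrite fhcompE /=.
- case: q; first by rewrite fhcomp0 if_same.
  by rewrite fhcompE /=; case: p.
- by rewrite fhcompD hx hy; case: ifP; rewrite ?addr0.
- rewrite fhcompD !fhcompM !hx !hy.
  by case: p q => [] [] /=; rewrite !(fmul0x, fmulx0, addr0, add0r).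
Qed.

Lemma fhcomp_mul p q x y :
  fhcomp (p (+) q) (fmul (fhcomp p x) (fhcomp q y)) =
  fmul (fhcomp p x) (fhcomp q y).
Proof.
rewrite fhcompM !fhcompK.
by case: p q => [] [] /=; rewrite !(fmul0x, fmulx0, addr0, add0r).
Qed.

HB.instance Definition _ := Lmodule_isSuperAlgebra.Build k F
  fmulA fmul1x fmulx1 fmulDl fmulDr fmulZl fmulZr
  fhcompD fhcompZ fhcomp_sum fhcompK fhcomp_mul.
HB.instance Definition _ :=
  GRing.PzRing.copy F (SuperAlgebra.sort F).

End FreeSuperAlgebra.
Arguments fgen {k G} par g.

(* The quotient of a superalgebra by the two-sided ideal generated by the
   homogeneous components of the differences x - y for R x y. *)
Section QuotientSuperAlgebra.
Variables (k : comPzRingType) (S : superAlgType k) (R : S -> S -> Prop).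

Inductive ideal : S -> Prop :=
| ideal_gen p x y : R x y -> ideal (hcomp p (x - y))
| ideal0 : ideal 0
| idealD x y : ideal x -> ideal y -> ideal (x + y)
| idealMl a x : ideal x -> ideal (a * x)
| idealMr a x : ideal x -> ideal (x * a).

Definition quot_eq (x y : S) : Prop := ideal (x - y).

Lemma idealZ c x : ideal x -> ideal (c *: x).
Proof. by move=> h; rewrite -[x]mul1r -superAl; apply: idealMl. Qed.

Lemma idealN x : ideal x -> ideal (- x).
Proof. by move=> h; rewrite -scaleN1r; apply: idealZ. Qed.

Lemma ideal_hcomp p x : ideal x -> ideal (hcomp p x).
Proof.
move=> h; elim: h p => [q y z h||y z _ hy _ hz|a y _ hy|a y _ hy] p.
- by rewrite hcompK; case: ifP => _; [apply: ideal_gen | apply: ideal0].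
- by rewrite hcomp0; apply: ideal0.
- by rewrite hcompD; apply: idealD.
- by rewrite hcompM; apply: idealD; apply: idealMl.
- by rewrite hcompM; apply: idealD; apply: idealMr.
Qed.

Lemma qe_eq x y : x = y -> quot_eq x y.
Proof. by move=> ->; rewrite /quot_eq subrr; apply: ideal0. Qed.

Lemma qe_refl x : quot_eq x x. Proof. exact: qe_eq. Qed.

Lemma qe_sym x y : quot_eq x y -> quot_eq y x.
Proof. by move=> /idealN; rewrite opprB. Qed.

Lemma qe_trans x y z : quot_eq x y -> quot_eq y z -> quot_eq x z.
Proof. by move=> xy yz; have := idealD xy yz; rewrite addrA subrK. Qed.

Lemma qe_add x x' y y' :
  quot_eq x x' -> quot_eq y y' -> quot_eq (x + y) (x' + y').
Proof. by move=> hx hy; rewrite /quot_eq opprD addrACA; apply: idealD. Qed.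

Lemma qe_scale (c : k) x x' : quot_eq x x' -> quot_eq (c *: x) (c *: x').
Proof. by move=> hx; rewrite /quot_eq -scalerBr; apply: idealZ. Qed.

Lemma qe_mul x x' y y' :
  quot_eq x x' -> quot_eq y y' -> quot_eq (x * y) (x' * y').
Proof.
move=> hx hy; apply: (qe_trans (y := x' * y)); rewrite /quot_eq.
  by rewrite -mulrBl; apply: idealMr.
by rewrite -mulrBr; apply: idealMl.
Qed.

Lemma qe_hcomp p x x' : quot_eq x x' -> quot_eq (hcomp p x) (hcomp p x').
Proof. by move=> hx; rewrite /quot_eq -hcompB; apply: ideal_hcomp. Qed.

Definition quot_setoid : setoidMod k := SetoidMod qe_refl qe_sym qe_trans
  qe_add qe_scale
  (fun x y z => qe_eq (addrA x y z)) (fun x y => qe_eq (addrC x y))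
  (fun x => qe_eq (add0r x)) (fun c d x => qe_eq (scalerA c d x))
  (fun x => qe_eq (scale1r x)) (fun x => qe_eq (scale0r x))
  (fun c x y => qe_eq (scalerDr c x y)) (fun c d x => qe_eq (scalerDl x c d)).

Definition quotSA : Type := smq quot_setoid.
HB.instance Definition _ := GRing.Lmodule.on quotSA.

Definition qproj (x : S) : quotSA := @cls k quot_setoid x.
Local Notation qrep := (@rep k quot_setoid : quotSA -> S).

Definition qmul (x y : quotSA) : quotSA := qproj (qrep x * qrep y).
Definition qhcomp (p : bool) (x : quotSA) : quotSA := qproj (hcomp p (qrep x)).

Lemma qprojP x y : qproj x = qproj y <-> quot_eq x y.
Proof. exact: (clsP (M := quot_setoid)). Qed.

Lemma qprojW (P : quotSA -> Prop) : (forall x, P (qproj x)) -> forall x, P x.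
Proof. exact: (clsW (M := quot_setoid)). Qed.

Lemma qprojD x y : qproj (x + y) = qproj x + qproj y.
Proof. exact: (clsD (M := quot_setoid)). Qed.

Lemma qprojZ (c : k) x : qproj (c *: x) = c *: qproj x.
Proof. exact: (clsZ (M := quot_setoid)). Qed.

Lemma qmulE x y : qmul (qproj x) (qproj y) = qproj (x * y).
Proof. by apply/qprojP/qe_mul; apply: (rep_cls (M := quot_setoid)). Qed.

Lemma qhcompE p x : qhcomp p (qproj x) = qproj (hcomp p x).
Proof. by apply/qprojP/qe_hcomp; apply: (rep_cls (M := quot_setoid)). Qed.

Lemma qmulA : associative qmul.
Proof.
elim/qprojW=> x; elim/qprojW=> y; elim/qprojW=> z.
by rewrite !qmulE mulrA.
Qed.

Lemma qmul1x : left_id (qproj 1) qmul.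
Proof. by elim/qprojW=> x; rewrite qmulE mul1r. Qed.

Lemma qmulx1 : right_id (qproj 1) qmul.
Proof. by elim/qprojW=> x; rewrite qmulE mulr1. Qed.

Lemma qmulDl : left_distributive qmul +%R.
Proof.
elim/qprojW=> x; elim/qprojW=> y; elim/qprojW=> z.
by rewrite -qprojD !qmulE -qprojD mulrDl.
Qed.

Lemma qmulDr : right_distributive qmul +%R.
Proof.
elim/qprojW=> x; elim/qprojW=> y; elim/qprojW=> z.
by rewrite -qprojD !qmulE -qprojD mulrDr.
Qed.

Lemma qmulZl (c : k) x y : qmul (c *: x) y = c *: qmul x y.
Proof.
elim/qprojW: x => x; elim/qprojW: y => y.
by rewrite -qprojZ !qmulE -qprojZ superAl.
Qed.

Lemma qmulZr (c : k) x y : qmul x (c *: y) = c *: qmul x y.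
Proof.
elim/qprojW: x => x; elim/qprojW: y => y.
by rewrite -qprojZ !qmulE -qprojZ superAr.
Qed.

Lemma qhcompD p : {morph qhcomp p : x y / x + y}.
Proof.
elim/qprojW=> x; elim/qprojW=> y.
by rewrite -qprojD !qhcompE hcompD qprojD.
Qed.

Lemma qhcompZ p (c : k) : {morph qhcomp p : x / c *: x}.
Proof. by elim/qprojW=> x; rewrite -qprojZ !qhcompE hcompZ qprojZ. Qed.

Lemma qhcomp_sum x : qhcomp false x + qhcomp true x = x.
Proof. by elim/qprojW: x => x; rewrite !qhcompE -qprojD hcomp_sum. Qed.

Lemma qhcompK p q x : qhcomp p (qhcomp q x) = if p == q then qhcomp q x else 0.
Proof. by elim/qprojW: x => x; rewrite !qhcompE hcompK; case: ifP. Qed.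

Lemma qhcompM p q x y :
  qhcomp (p (+) q) (qmul (qhcomp p x) (qhcomp q y)) =
  qmul (qhcomp p x) (qhcomp q y).
Proof.
elim/qprojW: x => x; elim/qprojW: y => y.
by rewrite (qhcompE p) (qhcompE q) qmulE qhcompE hcompMh.
Qed.

HB.instance Definition _ := Lmodule_isSuperAlgebra.Build k quotSA
  qmulA qmul1x qmulx1 qmulDl qmulDr qmulZl qmulZr
  qhcompD qhcompZ qhcomp_sum qhcompK qhcompM.
HB.instance Definition _ :=
  GRing.PzRing.copy quotSA (SuperAlgebra.sort quotSA).

End QuotientSuperAlgebra.
Arguments qproj {k S R} x.

(* The free product S1 * S2: generated by letters [a]_p, of parity p, for a in
   S1 or in S2, with the relations that make a |-> [a]_0 + [a]_1 a morphism of
   superalgebras on S1 and on S2. *)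
Section FreeProduct.
Variables (k : comPzRingType) (S1 S2 : superAlgType k).

Definition fp_free : superAlgType k :=
  freeSA k (@fst bool (S1 + S2)).

Definition letter (a : S1 + S2) : fp_free :=
  fgen fst (false, a) + fgen fst (true, a).

Inductive morph_rel (S : superAlgType k) (f : S -> fp_free) :
    fp_free -> fp_free -> Prop :=
| mr_add a b : morph_rel f (f (a + b)) (f a + f b)
| mr_scale c a : morph_rel f (f (c *: a)) (c *: f a)
| mr_one : morph_rel f (f 1) 1
| mr_mul a b : morph_rel f (f (a * b)) (f a * f b)
| mr_hcomp p a : morph_rel f (f (hcomp p a)) (hcomp p (f a)).

Definition fp_rel (x y : fp_free) : Prop :=
  morph_rel (fun a : S1 => letter (inl a)) x y \/
  morph_rel (fun b : S2 => letter (inr b)) x y.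

Definition freeprod : superAlgType k := quotSA fp_rel.
Definition fp_inl (a : S1) : freeprod := qproj (letter (inl a)).
Definition fp_inr (b : S2) : freeprod := qproj (letter (inr b)).

End FreeProduct.
Arguments fp_inl {k S1 S2} a.
Arguments fp_inr {k S1 S2} b.

(* The free product of A^(x)n and the free superalgebra on even u_i, modulo the
   nilCoxeter relations.  u_i crosses strands i and i+1 in the 0-based
   numbering.  The homogeneous components of the relators are relators again
   (for nr_slide, those of the components of a), so [quotSA] divides by the
   ordinary two-sided ideal which they generate. *)
Section NilCoxeterPresentation.
Variables (k : comPzRingType) (A : superAlgType k) (n : nat).

Definition evenSA : superAlgType k := freeSA k (fun _ : 'I_n.-1 => false).
Definition nilcox_free : superAlgType k := freeprod (tpow A n) evenSA.

Let u (i : 'I_n.-1) : nilcox_free :=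
  fp_inr (fgen (fun _ : 'I_n.-1 => false) i : evenSA).
Let emb (a : tpow A n) : nilcox_free := fp_inl a.

Inductive nilcox_rel : nilcox_free -> nilcox_free -> Prop :=
| nr_sq i : nilcox_rel (u i ^+ 2) 0
| nr_comm (i j : 'I_n.-1) : (i.+1 < j)%N || (j.+1 < i)%N ->
    nilcox_rel (u i * u j) (u j * u i)
| nr_braid (i j : 'I_n.-1) : j = i.+1 :> nat ->
    nilcox_rel (u i * u j * u i) (u j * u i * u j)
| nr_slide i (a : tpow A n) :
    nilcox_rel (u i * emb a) (emb (sact n i a) * u i).

Definition nilCoxPres : superAlgType k := quotSA nilcox_rel.
Definition pres_u (i : 'I_n.-1) : nilCoxPres := qproj (u i).
Definition pres_in (a : tpow A n) : nilCoxPres := qproj (emb a).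

End NilCoxeterPresentation.
Arguments pres_u {k} A {n} i.
Arguments pres_in {k A n} a.

(* The Frobenius nilCoxeter category N(A).  The object I^(x)n is represented by
   n, so the tensor product of objects is addition.  Morphisms are terms built
   from the generators and the operations of a k-linear monoidal category,
   modulo the congruence [mor_eq] generated by the axioms of a strict monoidal
   k-linear supercategory and the defining relations of N(A). *)
Section NilCoxeterCategory.
Variables (k : comPzRingType) (A : superAlgType k).

Inductive mor : nat -> nat -> Type :=
| mId n : mor n n
| mComp l m n of mor m n & mor l m : mor l n
| mTens m n m' n' of mor m n & mor m' n' : mor (m + m') (n + n')
| mX : mor 2 2
| mTok of A : mor 1 1
| mZero m n : mor m n
| mAdd m n of mor m n & mor m n : mor m n
| mScale m n of k & mor m n : mor m n.

Definition mcast m n m' n' (em : m = m') (en : n = n') (f : mor m n) :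
    mor m' n' := ecast i (mor i n') em (ecast j (mor m j) en f).

(* Homogeneity is read off the syntax of a term; by [nproj_rep] below, every
   homogeneous morphism is represented by such a term. *)
Fixpoint mhomog m n (f : mor m n) (p : bool) {struct f} : Prop :=
  match f with
  | mId _ => p = false
  | mComp _ _ _ f g => exists q, mhomog f q /\ mhomog g (p (+) q)
  | mTens _ _ _ _ f g => exists q, mhomog f q /\ mhomog g (p (+) q)
  | mX => p = false
  | mTok a => homog p a
  | mZero _ _ => True
  | mAdd _ _ f g => mhomog f p /\ mhomog g p
  | mScale _ _ _ f => mhomog f p
  end.

Inductive mor_eq : forall m n, mor m n -> mor m n -> Prop :=
| me_refl m n (f : mor m n) : mor_eq f f
| me_sym m n (f g : mor m n) : mor_eq f g -> mor_eq g f
| me_trans m n (f g h : mor m n) : mor_eq f g -> mor_eq g h -> mor_eq f h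
| me_comp l m n (f f' : mor m n) (g g' : mor l m) :
    mor_eq f f' -> mor_eq g g' -> mor_eq (mComp f g) (mComp f' g')
| me_tens m n m' n' (f f' : mor m n) (g g' : mor m' n') :
    mor_eq f f' -> mor_eq g g' -> mor_eq (mTens f g) (mTens f' g')
| me_add m n (f f' g g' : mor m n) :
    mor_eq f f' -> mor_eq g g' -> mor_eq (mAdd f g) (mAdd f' g')
| me_scale m n c (f f' : mor m n) :
    mor_eq f f' -> mor_eq (mScale c f) (mScale c f')
| me_addA m n (f g h : mor m n) :
    mor_eq (mAdd f (mAdd g h)) (mAdd (mAdd f g) h)
| me_addC m n (f g : mor m n) : mor_eq (mAdd f g) (mAdd g f)
| me_add0 m n (f : mor m n) : mor_eq (mAdd (mZero m n) f) f
| me_scaleA m n c d (f : mor m n) :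
    mor_eq (mScale c (mScale d f)) (mScale (c * d) f)
| me_scale1 m n (f : mor m n) : mor_eq (mScale 1 f) f
| me_scale0 m n (f : mor m n) : mor_eq (mScale 0 f) (mZero m n)
| me_scaleDr m n c (f g : mor m n) :
    mor_eq (mScale c (mAdd f g)) (mAdd (mScale c f) (mScale c g))
| me_scaleDl m n c d (f : mor m n) :
    mor_eq (mScale (c + d) f) (mAdd (mScale c f) (mScale d f))
| me_compDl l m n (f f' : mor m n) (g : mor l m) :
    mor_eq (mComp (mAdd f f') g) (mAdd (mComp f g) (mComp f' g))
| me_compDr l m n (f : mor m n) (g g' : mor l m) :
    mor_eq (mComp f (mAdd g g')) (mAdd (mComp f g) (mComp f g'))
| me_compZl l m n c (f : mor m n) (g : mor l m) :
    mor_eq (mComp (mScale c f) g) (mScale c (mComp f g))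
| me_compZr l m n c (f : mor m n) (g : mor l m) :
    mor_eq (mComp f (mScale c g)) (mScale c (mComp f g))
| me_tensDl m n m' n' (f f' : mor m n) (g : mor m' n') :
    mor_eq (mTens (mAdd f f') g) (mAdd (mTens f g) (mTens f' g))
| me_tensDr m n m' n' (f : mor m n) (g g' : mor m' n') :
    mor_eq (mTens f (mAdd g g')) (mAdd (mTens f g) (mTens f g'))
| me_tensZl m n m' n' c (f : mor m n) (g : mor m' n') :
    mor_eq (mTens (mScale c f) g) (mScale c (mTens f g))
| me_tensZr m n m' n' c (f : mor m n) (g : mor m' n') :
    mor_eq (mTens f (mScale c g)) (mScale c (mTens f g))
| me_compA l m n r (f : mor n r) (g : mor m n) (h : mor l m) :
    mor_eq (mComp f (mComp g h)) (mComp (mComp f g) h)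
| me_id_comp m n (f : mor m n) : mor_eq (mComp (mId n) f) f
| me_comp_id m n (f : mor m n) : mor_eq (mComp f (mId m)) f
| me_tensA m n m' n' m'' n'' (f : mor m n) (g : mor m' n') (h : mor m'' n'') :
    mor_eq (mcast (addnA m m' m'') (addnA n n' n'') (mTens f (mTens g h)))
           (mTens (mTens f g) h)
| me_unit_tens m n (f : mor m n) : mor_eq (mTens (mId 0) f) f
| me_tens_unit m n (f : mor m n) :
    mor_eq (mcast (addn0 m) (addn0 n) (mTens f (mId 0))) f
| me_tens_id m n : mor_eq (mTens (mId m) (mId n)) (mId (m + n))
| me_interchange p q l m n l' m' n'
    (f' : mor m n) (f : mor l m) (g : mor m' n') (g' : mor l' m') :
    mhomog f p -> mhomog g q ->
    mor_eq (mComp (mTens f' g) (mTens f g'))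
           (mScale (sgn k p q) (mTens (mComp f' f) (mComp g g')))
| me_tok1 : mor_eq (mTok 1) (mId 1)
| me_tok_lin c d a b :
    mor_eq (mTok (c *: a + d *: b))
           (mAdd (mScale c (mTok a)) (mScale d (mTok b)))
| me_tokM a b : mor_eq (mComp (mTok a) (mTok b)) (mTok (a * b))
| me_XX : mor_eq (mComp mX mX) (mZero 2 2)
| me_braid :
    mor_eq (mComp (mTens mX (mId 1)) (mComp (mTens (mId 1) mX) (mTens mX (mId 1))))
           (mComp (mTens (mId 1) mX) (mComp (mTens mX (mId 1)) (mTens (mId 1) mX)))
| me_slide_l a : mor_eq (mComp mX (mTens (mTok a) (mId 1)))
                        (mComp (mTens (mId 1) (mTok a)) mX)
| me_slide_r a : mor_eq (mComp mX (mTens (mId 1) (mTok a)))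
                        (mComp (mTens (mTok a) (mId 1)) mX).

Definition mor_setoid m n : setoidMod k := SetoidMod
  (@me_refl m n) (@me_sym m n) (@me_trans m n)
  (fun x x' y y' => @me_add m n x x' y y') (@me_scale m n)
  (@me_addA m n) (@me_addC m n) (@me_add0 m n) (@me_scaleA m n)
  (@me_scale1 m n) (@me_scale0 m n) (@me_scaleDr m n) (@me_scaleDl m n).

(* Hom_N(I^(x)m, I^(x)n) *)
Definition nHom m n : Type := smq (mor_setoid m n).
HB.instance Definition _ m n := GRing.Lmodule.on (nHom m n).

Definition ncls m n (f : mor m n) : nHom m n := @cls k (mor_setoid m n) f.
Local Notation nrep := (@rep k (mor_setoid _ _)).

Definition nid n : nHom n n := ncls (mId n).
Definition nX : nHom 2 2 := ncls mX.
Definition ntok (a : A) : nHom 1 1 := ncls (mTok a).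
Definition ncomp l m n (f : nHom m n) (g : nHom l m) : nHom l n :=
  ncls (mComp (nrep f) (nrep g)).
Definition ntens m n m' n' (f : nHom m n) (g : nHom m' n') :
    nHom (m + m') (n + n') := ncls (mTens (nrep f) (nrep g)).
Definition ncast m n m' n' (em : m = m') (en : n = n') (f : nHom m n) :
    nHom m' n' := ecast i (nHom i n') em (ecast j (nHom m j) en f).

Lemma nclsP m n (f g : mor m n) : ncls f = ncls g <-> mor_eq f g.
Proof. exact: (clsP (M := mor_setoid m n)). Qed.

Lemma nclsW m n (P : nHom m n -> Prop) :
  (forall f, P (ncls f)) -> forall x, P x.
Proof. exact: (clsW (M := mor_setoid m n)). Qed.

Lemma nclsD m n (f g : mor m n) : ncls (mAdd f g) = ncls f + ncls g.
Proof. exact: (clsD (M := mor_setoid m n)). Qed.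

Lemma nclsZ m n c (f : mor m n) : ncls (mScale c f) = c *: ncls f.
Proof. exact: (clsZ (M := mor_setoid m n)). Qed.

Lemma ncls0 m n : ncls (mZero m n) = 0. Proof. by []. Qed.

Lemma ncompE l m n (f : mor m n) (g : mor l m) :
  ncomp (ncls f) (ncls g) = ncls (mComp f g).
Proof. by apply/nclsP/me_comp; apply: (rep_cls (M := mor_setoid _ _)). Qed.

Lemma ntensE m n m' n' (f : mor m n) (g : mor m' n') :
  ntens (ncls f) (ncls g) = ncls (mTens f g).
Proof. by apply/nclsP/me_tens; apply: (rep_cls (M := mor_setoid _ _)). Qed.

Lemma ncastE m n m' n' (em : m = m') (en : n = n') (f : mor m n) :
  ncast em en (ncls f) = ncls (mcast em en f).
Proof. by case: m' / em; case: n' / en. Qed.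

Lemma ncompDl l m n (f f' : nHom m n) (g : nHom l m) :
  ncomp (f + f') g = ncomp f g + ncomp f' g.
Proof.
elim/nclsW: f => f; elim/nclsW: f' => f'; elim/nclsW: g => g.
by rewrite -nclsD !ncompE -nclsD; apply/nclsP/me_compDl.
Qed.

Lemma ncompDr l m n (f : nHom m n) (g g' : nHom l m) :
  ncomp f (g + g') = ncomp f g + ncomp f g'.
Proof.
elim/nclsW: f => f; elim/nclsW: g => g; elim/nclsW: g' => g'.
by rewrite -nclsD !ncompE -nclsD; apply/nclsP/me_compDr.
Qed.

Lemma ncompZl l m n (c : k) (f : nHom m n) (g : nHom l m) :
  ncomp (c *: f) g = c *: ncomp f g.
Proof.
elim/nclsW: f => f; elim/nclsW: g => g.
by rewrite -nclsZ !ncompE -nclsZ; apply/nclsP/me_compZl.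
Qed.

Lemma ncompZr l m n (c : k) (f : nHom m n) (g : nHom l m) :
  ncomp f (c *: g) = c *: ncomp f g.
Proof.
elim/nclsW: f => f; elim/nclsW: g => g.
by rewrite -nclsZ !ncompE -nclsZ; apply/nclsP/me_compZr.
Qed.

Lemma ntensDl m n m' n' (f f' : nHom m n) (g : nHom m' n') :
  ntens (f + f') g = ntens f g + ntens f' g.
Proof.
elim/nclsW: f => f; elim/nclsW: f' => f'; elim/nclsW: g => g.
by rewrite -nclsD !ntensE -nclsD; apply/nclsP/me_tensDl.
Qed.

Lemma ntensDr m n m' n' (f : nHom m n) (g g' : nHom m' n') :
  ntens f (g + g') = ntens f g + ntens f g'.
Proof.
elim/nclsW: f => f; elim/nclsW: g => g; elim/nclsW: g' => g'.
by rewrite -nclsD !ntensE -nclsD; apply/nclsP/me_tensDr.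
Qed.

Lemma ntensZl m n m' n' (c : k) (f : nHom m n) (g : nHom m' n') :
  ntens (c *: f) g = c *: ntens f g.
Proof.
elim/nclsW: f => f; elim/nclsW: g => g.
by rewrite -nclsZ !ntensE -nclsZ; apply/nclsP/me_tensZl.
Qed.

Lemma ntensZr m n m' n' (c : k) (f : nHom m n) (g : nHom m' n') :
  ntens f (c *: g) = c *: ntens f g.
Proof.
elim/nclsW: f => f; elim/nclsW: g => g.
by rewrite -nclsZ !ntensE -nclsZ; apply/nclsP/me_tensZr.
Qed.

Lemma ncomp0l l m n (g : nHom l m) : ncomp (0 : nHom m n) g = 0.
Proof. by rewrite -(scale0r (0 : nHom m n)) ncompZl scale0r. Qed.
Lemma ncomp0r l m n (f : nHom m n) : ncomp f (0 : nHom l m) = 0.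
Proof. by rewrite -(scale0r (0 : nHom l m)) ncompZr scale0r. Qed.
Lemma ntens0l m n m' n' (g : nHom m' n') : ntens (0 : nHom m n) g = 0.
Proof. by rewrite -(scale0r (0 : nHom m n)) ntensZl scale0r. Qed.
Lemma ntens0r m n m' n' (f : nHom m n) : ntens f (0 : nHom m' n') = 0.
Proof. by rewrite -(scale0r (0 : nHom m' n')) ntensZr scale0r. Qed.

Lemma ncompA l m n r (f : nHom n r) (g : nHom m n) (h : nHom l m) :
  ncomp f (ncomp g h) = ncomp (ncomp f g) h.
Proof.
elim/nclsW: f => f; elim/nclsW: g => g; elim/nclsW: h => h.
by rewrite !ncompE; apply/nclsP/me_compA.
Qed.

Lemma ncomp_idl m n (f : nHom m n) : ncomp (nid n) f = f.
Proof. by elim/nclsW: f => f; rewrite ncompE; apply/nclsP/me_id_comp. Qed.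

Lemma ncomp_idr m n (f : nHom m n) : ncomp f (nid m) = f.
Proof. by elim/nclsW: f => f; rewrite ncompE; apply/nclsP/me_comp_id. Qed.

Lemma ntensA m n m' n' m'' n'' (f : nHom m n) (g : nHom m' n')
    (h : nHom m'' n'') :
  ncast (addnA m m' m'') (addnA n n' n'') (ntens f (ntens g h)) =
  ntens (ntens f g) h.
Proof.
elim/nclsW: f => f; elim/nclsW: g => g; elim/nclsW: h => h.
by rewrite !ntensE ncastE; apply/nclsP/me_tensA.
Qed.

Lemma ntens_idl m n (f : nHom m n) : ntens (nid 0) f = f.
Proof. by elim/nclsW: f => f; rewrite ntensE; apply/nclsP/me_unit_tens. Qed.

Lemma ntens_idr m n (f : nHom m n) :
  ncast (addn0 m) (addn0 n) (ntens f (nid 0)) = f.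
Proof. by elim/nclsW: f => f; rewrite ntensE ncastE; apply/nclsP/me_tens_unit. Qed.

Lemma ncastD m n m' n' (em : m = m') (en : n = n') :
  {morph ncast em en : x y / x + y}.
Proof. by case: m' / em; case: n' / en. Qed.

Lemma ncast0 m n m' n' (em : m = m') (en : n = n') : ncast em en 0 = 0.
Proof. by case: m' / em; case: n' / en. Qed.

Fixpoint nproj (p : bool) m n (f : mor m n) : nHom m n :=
  match f with
  | mId n => if p then 0 else nid n
  | mComp _ _ _ f g => ncomp (nproj false f) (nproj p g) +
                       ncomp (nproj true f) (nproj (~~ p) g)
  | mTens _ _ _ _ f g => ntens (nproj false f) (nproj p g) +
                         ntens (nproj true f) (nproj (~~ p) g)
  | mX => if p then 0 else nX
  | mTok a => ntok (hcomp p a)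
  | mZero _ _ => 0
  | mAdd _ _ f g => nproj p f + nproj p g
  | mScale _ _ c f => c *: nproj p f
  end.

Lemma nproj_cast p m n m' n' (em : m = m') (en : n = n') (f : mor m n) :
  nproj p (mcast em en f) = ncast em en (nproj p f).
Proof. by case: m' / em; case: n' / en. Qed.

Lemma ntokDZ c d a b : ntok (c *: a + d *: b) = c *: ntok a + d *: ntok b.
Proof. by rewrite -!nclsZ -nclsD; apply/nclsP/me_tok_lin. Qed.

Lemma ntok0 : ntok 0 = 0.
Proof. by rewrite -[0 in LHS]addr0 -(scale0r (0 : A)) ntokDZ !scale0r addr0. Qed.

Lemma ntokD a b : ntok (a + b) = ntok a + ntok b.
Proof. by rewrite -[a]scale1r -[b]scale1r ntokDZ !scale1r. Qed.

Lemma nproj_sum m n (f : mor m n) : nproj false f + nproj true f = ncls f.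
Proof.
elim: m n / f => /=.
- by move=> n; rewrite addr0.
- move=> l m n f hf g hg; rewrite -ncompE -hf -hg !(ncompDl, ncompDr) -!addrA.
  by congr (_ + _); rewrite addrC addrA.
- move=> m n m' n' f hf g hg.
  rewrite -ntensE -hf -hg !(ntensDl, ntensDr) -!addrA.
  by congr (_ + _); rewrite addrC addrA.
- exact: addr0.
- by move=> a; rewrite -ntokD hcomp_sum.
- by move=> m n; rewrite addr0.
- by move=> m n f hf g hg; rewrite addrACA hf hg nclsD.
- by move=> m n c f hf; rewrite -scalerDr hf nclsZ.
Qed.

Lemma nproj_homog m n (f : mor m n) p q : mhomog f p ->
  nproj q f = if q == p then ncls f else 0.
Proof.
move=> h; suff Z : nproj (~~ p) f = 0.
  have := nproj_sum f; case: p q Z {h} => [] [] /= ->;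
    by rewrite ?addr0 ?add0r.
elim: m n / f p h {q} => /=.
- by move=> n p ->.
- move=> l m n f hf g hg p [q [/hf zf /hg zg]]; rewrite negbK.
  by case: p q zf zg => [] [] /= -> ->; rewrite !(ncomp0l, ncomp0r) addr0.
- move=> m n m' n' f hf g hg p [q [/hf zf /hg zg]]; rewrite negbK.
  by case: p q zf zg => [] [] /= -> ->; rewrite !(ntens0l, ntens0r) addr0.
- by move=> p ->.
- by move=> a p h; rewrite (homog_neq _ h); case: p {h} => /=; rewrite ntok0.
- by [].
- by move=> m n f hf g hg p [/hf -> /hg ->]; rewrite addr0.
- by move=> m n c f hf p /hf ->; rewrite scaler0.
Qed.

Lemma nproj_rep m n (f : mor m n) p :
  exists2 f', mhomog f' p & ncls f' = nproj p f.
Proof.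
elim: m n / f p => /=.
- by move=> n [|]; [exists (mZero n n) | exists (mId n)].
- move=> l m n f hf g hg p.
  have [f0 f0h <-] := hf false; have [f1 f1h <-] := hf true.
  have [g0 g0h <-] := hg p; have [g1 g1h <-] := hg (~~ p).
  exists (mAdd (mComp f0 g0) (mComp f1 g1)); last by rewrite nclsD !ncompE.
  by split; [exists false | exists true]; rewrite ?addbF ?addbT.
- move=> m n m' n' f hf g hg p.
  have [f0 f0h <-] := hf false; have [f1 f1h <-] := hf true.
  have [g0 g0h <-] := hg p; have [g1 g1h <-] := hg (~~ p).
  exists (mAdd (mTens f0 g0) (mTens f1 g1)); last by rewrite nclsD !ntensE.
  by split; [exists false | exists true]; rewrite ?addbF ?addbT.
- by move=> [|]; [exists (mZero 2 2) | exists mX].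
- by move=> a p; exists (mTok (hcomp p a)) => //; apply: homog_hcomp.
- by move=> m n p; exists (mZero m n).
- move=> m n f hf g hg p; have [f' ? <-] := hf p; have [g' ? <-] := hg p.
  by exists (mAdd f' g') => //; rewrite nclsD.
- move=> m n c f hf p; have [f' ? <-] := hf p.
  by exists (mScale c f') => //; rewrite nclsZ.
Qed.

Lemma ninterchange p q l m n l' m' n' (f' : nHom m n) (f : mor l m)
    (g : mor m' n') (g' : nHom l' m') : mhomog f p -> mhomog g q ->
  ncomp (ntens f' (ncls g)) (ntens (ncls f) g') =
  sgn k p q *: ntens (ncomp f' (ncls f)) (ncomp (ncls g) g').
Proof.
move=> hf hg; elim/nclsW: f' => f'; elim/nclsW: g' => g'.
rewrite (ntensE f' g) (ntensE f g') (ncompE f' f) (ncompE g g').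
rewrite ncompE ntensE -nclsZ; apply/nclsP.
exact: me_interchange.
Qed.

Lemma nprojP m n (f g : mor m n) : mor_eq f g -> forall p, nproj p f = nproj p g.
Proof.
elim: m n f g / => /=.
- by [].
- by [].
- by move=> m n f g h _ e1 _ e2 p; rewrite e1 e2.
- by move=> l m n f f' g g' _ e1 _ e2 p; rewrite !e1 !e2.
- by move=> m n m' n' f f' g g' _ e1 _ e2 p; rewrite !e1 !e2.
- by move=> m n f f' g g' _ e1 _ e2 p; rewrite e1 e2.
- by move=> m n c f f' _ e p; rewrite e.
- by move=> *; rewrite addrA.
- by move=> *; rewrite addrC.
- by move=> *; rewrite add0r.
- by move=> *; rewrite scalerA.
- by move=> *; rewrite scale1r.
- by move=> *; rewrite scale0r.
- by move=> *; rewrite scalerDr.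
- by move=> *; rewrite scalerDl.
- by move=> *; rewrite !ncompDl addrACA.
- by move=> *; rewrite !ncompDr addrACA.
- by move=> *; rewrite !ncompZl scalerDr.
- by move=> *; rewrite !ncompZr scalerDr.
- by move=> *; rewrite !ntensDl addrACA.
- by move=> *; rewrite !ntensDr addrACA.
- by move=> *; rewrite !ntensZl scalerDr.
- by move=> *; rewrite !ntensZr scalerDr.
- move=> l m n r f g h p.
  rewrite !(ncompDl, ncompDr) !ncompA negbK -!addrA; congr (_ + _).
  by rewrite addrC -addrA addrC -addrA; congr (_ + _); rewrite addrC.
- by move=> m n f p; rewrite ncomp0l addr0 ncomp_idl.
- by move=> m n f []; rewrite /= ncomp0r ?addr0 ?add0r ncomp_idr.
- move=> m n m' n' m'' n'' f g h p; rewrite nproj_cast /=.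
  rewrite !(ntensDl, ntensDr) !ncastD !ntensA negbK -!addrA; congr (_ + _).
  by rewrite addrC -addrA addrC -addrA; congr (_ + _); rewrite addrC.
- by move=> m n f p; rewrite ntens0l addr0 ntens_idl.
- move=> m n f p; rewrite nproj_cast /= ncastD.
  by case: p; rewrite /= ntens0r ncast0 ?addr0 ?add0r ntens_idr.
- move=> m n []; rewrite !(ntens0l, ntens0r) addr0 // ntensE.
  exact/nclsP/me_tens_id.
- move=> p q l m n l' m' n' f' f g g' hf hg r.
  rewrite !(nproj_homog _ hf) !(nproj_homog _ hg).
  have I a d : ncomp (ntens (nproj a f') (ncls g)) (ntens (ncls f) (nproj d g'))
    = sgn k p q *:
      ntens (ncomp (nproj a f') (ncls f)) (ncomp (ncls g) (nproj d g')).
    exact: ninterchange.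
  case: p q r I {hf hg} => [] [] [] /= I;
    rewrite ?(ntens0l, ntens0r, addr0, add0r, ncomp0l, ncomp0r) !I -?scalerDr //.
  all: try by congr (_ *: _); rewrite addrC.
- move=> p; rewrite (homog_neq _ (homog1 A)).
  by case: p; rewrite /= ?ntok0 //; apply/nclsP/me_tok1.
- by move=> c d a b p; rewrite hcompD !hcompZ ntokDZ.
- move=> a b p; rewrite hcompM ntokD.
  by congr (_ + _); rewrite [LHS]ncompE; apply/nclsP/me_tokM.
- case; rewrite !(ncomp0l, ncomp0r) !addr0 //.
  by rewrite [LHS]ncompE; apply/nclsP/me_XX.
- case; rewrite !(ntens0l, ntens0r) ?addr0 ?add0r !(ncomp0l, ncomp0r) ?addr0;
    rewrite ?ncomp0r //.
  have B (f g : mor 3 3) : mor_eq (mComp f (mComp g f)) (mComp g (mComp f g)) ->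
      ncomp (ncls f) (ncomp (ncls g) (ncls f)) =
      ncomp (ncls g) (ncomp (ncls f) (ncls g)).
    by move=> /nclsP; rewrite -!ncompE.
  rewrite [ntens nX _]ntensE [ntens _ nX]ntensE; apply: B; exact: me_braid.
- move=> a p; have E b : ncomp nX (ntens (ntok b) (nid 1)) =
                         ncomp (ntens (nid 1) (ntok b)) nX.
    rewrite [ntens _ (nid 1)]ntensE [ntens (nid 1) _]ntensE [LHS]ncompE [RHS]ncompE.
    exact/nclsP/me_slide_l.
  by case: p;
    rewrite /= ?(ntens0l, ntens0r, addr0, add0r, ncomp0l, ncomp0r) E.
- move=> a p; have E b : ncomp nX (ntens (nid 1) (ntok b)) =
                         ncomp (ntens (ntok b) (nid 1)) nX.
    rewrite [ntens _ (nid 1)]ntensE [ntens (nid 1) _]ntensE [LHS]ncompE [RHS]ncompE.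
    exact/nclsP/me_slide_r.
  by case: p;
    rewrite /= ?(ntens0l, ntens0r, addr0, add0r, ncomp0l, ncomp0r) E.
Qed.

(* The endomorphism superalgebra nilCox_n(A) = End_N(I^(x)n), with composition
   as multiplication. *)
Definition nilCox (n : nat) : Type := nHom n n.
HB.instance Definition _ n := GRing.Lmodule.on (nilCox n).

Definition nhcomp n (p : bool) (x : nilCox n) : nilCox n :=
  nproj p (@rep k (mor_setoid n n) x).

Lemma nhcompE n p (f : mor n n) : nhcomp p (ncls f : nilCox n) = nproj p f.
Proof. exact/nprojP/(rep_cls (M := mor_setoid n n)). Qed.

Lemma nmulA n : associative (fun x y : nilCox n => ncomp x y : nilCox n).
Proof. by move=> x y z; apply: ncompA. Qed.
Lemma nmul1x n : left_id (nid n : nilCox n)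
  (fun x y : nilCox n => ncomp x y : nilCox n).
Proof. by move=> x; apply: ncomp_idl. Qed.
Lemma nmulx1 n : right_id (nid n : nilCox n)
  (fun x y : nilCox n => ncomp x y : nilCox n).
Proof. by move=> x; apply: ncomp_idr. Qed.
Lemma nmulDl n : left_distributive (fun x y : nilCox n => ncomp x y : nilCox n) +%R.
Proof. by move=> x y z; apply: ncompDl. Qed.
Lemma nmulDr n : right_distributive (fun x y : nilCox n => ncomp x y : nilCox n) +%R.
Proof. by move=> x y z; apply: ncompDr. Qed.

Lemma nhcompD n p : {morph @nhcomp n p : x y / x + y}.
Proof.
elim/nclsW=> x; elim/nclsW=> y.
by rewrite -[_ + _](nclsD x y) !nhcompE.
Qed.

Lemma nhcompZ n p (c : k) : {morph @nhcomp n p : x / c *: x}.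
Proof. by elim/nclsW=> x; rewrite -[_ *: _](nclsZ c x) !nhcompE. Qed.

Lemma nhcomp_sum n (x : nilCox n) : nhcomp false x + nhcomp true x = x.
Proof. by elim/nclsW: x => x; rewrite !nhcompE; apply: nproj_sum. Qed.

Lemma nhcompK n p q (x : nilCox n) :
  nhcomp p (nhcomp q x) = if p == q then nhcomp q x else 0.
Proof.
elim/nclsW: x => x; rewrite (nhcompE q); have [x' hx' <-] := nproj_rep x q.
by rewrite nhcompE (nproj_homog _ hx').
Qed.

Lemma nhcompM n p q (x y : nilCox n) :
  nhcomp (p (+) q) (ncomp (nhcomp p x) (nhcomp q y)) =
  ncomp (nhcomp p x) (nhcomp q y).
Proof.
elim/nclsW: x => x; elim/nclsW: y => y; rewrite (nhcompE p) (nhcompE q).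
have [x' hx' <-] := nproj_rep x p; have [y' hy' <-] := nproj_rep y q.
rewrite ncompE nhcompE (@nproj_homog _ _ _ (p (+) q)) ?eqxx //.
by exists p; rewrite addbC addKb.
Qed.

HB.instance Definition _ n := Lmodule_isSuperAlgebra.Build k (nilCox n)
  (@nmulA n) (@nmul1x n) (@nmulx1 n) (@nmulDl n) (@nmulDr n)
  (fun c x y => ncompZl c x y) (fun c x y => ncompZr c x y)
  (@nhcompD n) (@nhcompZ n) (@nhcomp_sum n) (@nhcompK n) (@nhcompM n).
HB.instance Definition _ n :=
  GRing.PzRing.copy (nilCox n) (SuperAlgebra.sort (nilCox n)).

Lemma crossing_dim n (i : 'I_n.-1) : (n - i.+2 + 2 + i = n)%N.
Proof. by case: i => i /=; lia. Qed.

Lemma token_dim n (i : 'I_n) : (n - i.+1 + 1 + i = n)%N.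
Proof. by case: i => i /=; lia. Qed.

(* 1^(x)(n-i-2) (x) X (x) 1^(x)i and 1^(x)(n-i-1) (x) t_a (x) 1^(x)i, with i
   counted from 0. *)
Definition crossing n (i : 'I_n.-1) : nilCox n :=
  ncast (crossing_dim i) (crossing_dim i)
    (ntens (ntens (nid (n - i.+2)) nX) (nid i)).

Definition token n (i : 'I_n) (a : A) : nilCox n :=
  ncast (token_dim i) (token_dim i)
    (ntens (ntens (nid (n - i.+1)) (ntok a)) (nid i)).

End NilCoxeterCategory.

Arguments nilCox {k} A n.
Arguments crossing {k} A {n} i.
Arguments token {k A n} i a.

(* Main.v *)
Require Import Defs.
From HB Require Import structures.
From mathcomp Require Import all_boot all_algebra.
From mathcomp Require Import zify.
Set Implicit Arguments.
Unset Strict Implicit.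
Unset Printing Implicit Defensive.
Import GRing.Theory.
Local Open Scope ring_scope.

(* Call a family of even crossings U_i and tokens T_i(a) in a superalgebra B,
   subject to the nilCoxeter relations, a nilCoxeter family on N strands.  By
   the universal property of A^(x)N, such a family amounts to a morphism from
   the presented algebra to B.  It also evaluates morphisms of the category: a
   term drawn on the strands i, i+1, ... of I^(x)N is sent to the product of its
   generators, an operation compatible with the super interchange law because
   homogeneous terms drawn on disjoint strands supercommute in B.  The generators
   of the presented algebra and of End(I^(x)N) both form such families, and the
   two resulting morphisms are inverse to each other because they match
   generators. *)


(** * Morphisms of superalgebras and universal properties *)

(** In the category, strictness of the tensor product is stated through casts along equalities in
    [nat]. Values in a superalgebra do not see these casts, so casts have to be handled only for the
    category's own family. A second obstacle is that a term from [n] to [n] may be a composite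
    through an object [m] different from [n]. Every generator is an endomorphism, so such a
    composite is zero; this is shown once for values and once for morphisms. No basis of either
    algebra is required. One composite fixes the generators of the presented algebra. The other is
    the identity because evaluating a term in the category's own family gives back the morphism that
    the term represents. *)

Record sa_morph (k : comPzRingType) (S B : superAlgType k) (f : S -> B) :
    Prop := SaMorph {
  samD : {morph f : x y / x + y};
  samZ : forall c, {morph f : x / c *: x};
  sam1 : f 1 = 1;
  samM : {morph f : x y / x * y};
  samH : forall p, {morph f : x / hcomp p x} }.

Section Morphisms.
Variables (k : comPzRingType) (S B : superAlgType k).

Lemma sam0 (f : S -> B) : sa_morph f -> f 0 = 0.
Proof. by move=> hf; rewrite -(scale0r (0 : S)) samZ // scale0r. Qed.

Lemma samN (f : S -> B) : sa_morph f -> {morph f : x / - x}.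
Proof. by move=> hf x; rewrite -scaleN1r samZ // scaleN1r. Qed.

Lemma samB (f : S -> B) : sa_morph f -> {morph f : x y / x - y}.
Proof. by move=> hf x y; rewrite samD // samN. Qed.

Lemma sam_homog (f : S -> B) p x : sa_morph f -> homog p x -> homog p (f x).
Proof. by move=> hf hx; rewrite /homog -samH // hx. Qed.

Lemma sam_comp (C : superAlgType k) (g : B -> C) (f : S -> B) :
  sa_morph g -> sa_morph f -> sa_morph (g \o f).
Proof.
move=> hg hf; split=> [x y|c x||x y|p x] /=.
- by rewrite (samD hf) (samD hg).
- by rewrite (samZ hf) (samZ hg).
- by rewrite (sam1 hf) (sam1 hg).
- by rewrite (samM hf) (samM hg).
- by rewrite (samH hf) (samH hg).
Qed.

Lemma sam_id : sa_morph (@id S). Proof. by []. Qed.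

End Morphisms.

(** * Morphisms out of the free superalgebra *)

Section FreeLift.
Variables (k : comPzRingType) (G : Type) (par : G -> bool).
Local Notation fcls := (@cls k (free_setoid k G) : _ -> freeSA k par).

Lemma free_mulE x y : fcls x * fcls y = fcls (FMul x y).
Proof. exact: (@fmulE _ _ par). Qed.

Lemma free_hcompE p t : hcomp p (fcls t) = fproj par p t.
Proof. exact: fhcompE. Qed.

Lemma free_scalE c : fcls (FScal G c) = c *: (1 : freeSA k par).
Proof. by rewrite -[RHS](@fclsZ _ _ par); apply/fclsP/fe_sym/fe_mulx1. Qed.

Variables (B : superAlgType k) (v : G -> B).

Fixpoint fval (t : free_term k G) : B :=
  match t with
  | FGen g => v g
  | FScal c => c *: (1 : B)
  | FAdd x y => fval x + fval y
  | FMul x y => fval x * fval y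
  end.

Lemma fvalP t t' : free_eq t t' -> fval t = fval t'.
Proof.
elim=> //=.
- by move=> x y z _ -> _ ->.
- by move=> x x' y y' _ -> _ ->.
- by move=> x x' y y' _ -> _ ->.
- by move=> *; rewrite addrA.
- by move=> *; rewrite addrC.
- by move=> *; rewrite scale0r add0r.
- by move=> *; rewrite mulrA.
- by move=> *; rewrite scale1r mul1r.
- by move=> *; rewrite scale1r mulr1.
- by move=> *; rewrite scale0r mul0r.
- by move=> *; rewrite mulrDl.
- by move=> *; rewrite mulrDr.
- by move=> *; rewrite scalerDl.
- by move=> *; rewrite superAl mul1r scalerA.
- by move=> *; rewrite superAl superAr mul1r mulr1.
Qed.

Definition free_lift (x : freeSA k par) : B := fval (rep (M := free_setoid k G) x).

Lemma free_lift_cls t : free_lift (cls (M := free_setoid k G) t) = fval t.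
Proof. exact/fvalP/(rep_cls (M := free_setoid k G)). Qed.

Lemma free_lift_gen g : free_lift (fgen par g) = v g.
Proof. exact: free_lift_cls. Qed.

Hypothesis vpar : forall g, homog (par g) (v g).

(** Compatibility with the grading goes by induction on terms: [fproj] obeys the same product rule
    as [hcompM], and [vpar] settles the generators. *)
Lemma free_liftP : sa_morph free_lift.
Proof.
have hD : {morph free_lift : x y / x + y}.
  elim/fclsW=> x; elim/fclsW=> y.
  by rewrite -(@fclsD _ _ par) !free_lift_cls.
have hM : {morph free_lift : x y / x * y}.
  elim/fclsW=> x; elim/fclsW=> y.
  by rewrite free_mulE !free_lift_cls.
split=> //.
- move=> c; elim/fclsW=> x.
  by rewrite -(@fclsZ _ _ par) !free_lift_cls /= superAl mul1r.
- by rewrite -[1]scale1r -free_scalE free_lift_cls /= scale1r.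
- move=> p; elim/fclsW=> t; rewrite free_hcompE free_lift_cls.
  have L0 : free_lift 0 = 0 by rewrite -fscal0 free_lift_cls /= scale0r.
  elim: t p => [g|c|x hx y hy|x hx y hy] p /=.
  + rewrite (homog_neq _ (vpar g)); case: eqP => _ //; exact: free_lift_gen.
  + rewrite hcompZ (homog_neq _ (homog1 B)).
    by case: p => /=; rewrite ?scaler0; [exact: L0 | exact: free_lift_cls].
  + by rewrite hD hx hy hcompD.
  + have hM' a b : free_lift (fmul a b) = free_lift a * free_lift b by exact: hM.
    by rewrite hD !hM' !hx !hy -hcompM.
Qed.

Lemma freeSA_ext (f g : freeSA k par -> B) : sa_morph f -> sa_morph g ->
  (forall x, f (fgen par x) = g (fgen par x)) -> f =1 g.
Proof.
move=> hf hg fg; elim/fclsW=> t.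
elim: t => [x|c|x hx y hy|x hx y hy].
- exact: fg.
- by rewrite free_scalE (samZ hf) (samZ hg) (sam1 hf) (sam1 hg).
- by rewrite (@fclsD _ _ par) (samD hf) (samD hg) hx hy.
- by rewrite -free_mulE (samM hf) (samM hg) hx hy.
Qed.

End FreeLift.

(** * Morphisms out of a quotient *)

Section QuotLift.
Variables (k : comPzRingType) (S B : superAlgType k) (R : S -> S -> Prop).

Lemma qproj_sam : sa_morph (@qproj k S R).
Proof.
split=> [x y|c x||x y|p x].
- exact: qprojD.
- exact: qprojZ.
- by [].
- by rewrite -qmulE.
- by rewrite -qhcompE.
Qed.

(** The ideal is generated by the components of [x - y]; the relator itself is their sum. *)
Lemma qproj_rel x y : R x y -> @qproj k S R x = qproj y.
Proof.
move=> h; apply/qprojP; rewrite /quot_eq -[x - y]hcomp_sum.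
by apply: idealD; apply: ideal_gen.
Qed.

Definition quot_lift (f : S -> B) (x : quotSA R) : B :=
  f (rep (M := quot_setoid R) x).

Variable f : S -> B.
Hypotheses (hf : sa_morph f) (fR : forall x y, R x y -> f x = f y).

(** By induction on membership, [f] kills the ideal. Since the generators are homogeneous components
    of relators, this uses that [f] preserves the grading. *)
Lemma quot_lift_proj x : quot_lift f (qproj x) = f x.
Proof.
have : quot_eq R (rep (M := quot_setoid R) (qproj x)) x.
  exact: (rep_cls (M := quot_setoid R)).
rewrite /quot_lift /quot_eq; move: (rep _) => y hy.
suff : f (y - x) = 0 by rewrite (samB hf) => /eqP; rewrite subr_eq0 => /eqP.
elim: hy => [p a b /fR e||a b _ ha _ hb|a b _ hb|a b _ hb].
- by rewrite (samH hf) (samB hf) e subrr hcomp0.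
- exact: sam0.
- by rewrite (samD hf) ha hb addr0.
- by rewrite (samM hf) hb mulr0.
- by rewrite (samM hf) hb mul0r.
Qed.

Lemma quot_liftP : sa_morph (quot_lift f).
Proof.
have hq := qproj_sam.
split.
- elim/qprojW=> x; elim/qprojW=> y.
  by rewrite -(samD hq) !quot_lift_proj (samD hf).
- by move=> c; elim/qprojW=> x; rewrite -(samZ hq) !quot_lift_proj (samZ hf).
- by rewrite -(sam1 hq) quot_lift_proj (sam1 hf).
- elim/qprojW=> x; elim/qprojW=> y.
  by rewrite -(samM hq) !quot_lift_proj (samM hf).
- by move=> p; elim/qprojW=> x; rewrite -(samH hq) !quot_lift_proj (samH hf).
Qed.

End QuotLift.

(** * Morphisms out of a free product *)

Section FreeProductLift.
Variables (k : comPzRingType) (S1 S2 B : superAlgType k).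

(** Each free generator is recovered from a letter, so a morphism out of the free product is
    determined by its values on letters. *)
Lemma hcomp_letter p (s : S1 + S2) :
  hcomp p (letter s) = fgen fst (p, s) :> fp_free S1 S2.
Proof.
rewrite /letter hcompD !free_hcompE /=.
by case: p; rewrite /= ?addr0 ?add0r.
Qed.

Lemma fp_inl_sam : sa_morph (@fp_inl k S1 S2).
Proof.
have hq := @qproj_sam k (fp_free S1 S2) (@fp_rel k S1 S2).
have R x y : morph_rel (fun a : S1 => letter (inl a)) x y ->
  @qproj k _ (@fp_rel k S1 S2) x = qproj y by move=> h; apply: qproj_rel; left.
split=> [x y|c x||x y|p x]; rewrite /fp_inl.
- by rewrite -(samD hq); apply: (R _ _ (mr_add _ x y)).
- by rewrite -(samZ hq); apply: (R _ _ (mr_scale _ c x)).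
- by rewrite -(sam1 hq); apply: (R _ _ (mr_one _)).
- by rewrite -(samM hq); apply: (R _ _ (mr_mul _ x y)).
- by rewrite -(samH hq); apply: (R _ _ (mr_hcomp _ p x)).
Qed.

Lemma fp_inr_sam : sa_morph (@fp_inr k S1 S2).
Proof.
have hq := @qproj_sam k (fp_free S1 S2) (@fp_rel k S1 S2).
have R x y : morph_rel (fun a : S2 => letter (inr a)) x y ->
  @qproj k _ (@fp_rel k S1 S2) x = qproj y by move=> h; apply: qproj_rel; right.
split=> [x y|c x||x y|p x]; rewrite /fp_inr.
- by rewrite -(samD hq); apply: (R _ _ (mr_add _ x y)).
- by rewrite -(samZ hq); apply: (R _ _ (mr_scale _ c x)).
- by rewrite -(sam1 hq); apply: (R _ _ (mr_one _)).
- by rewrite -(samM hq); apply: (R _ _ (mr_mul _ x y)).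
- by rewrite -(samH hq); apply: (R _ _ (mr_hcomp _ p x)).
Qed.

Lemma freeprod_ext (f g : freeprod S1 S2 -> B) : sa_morph f -> sa_morph g ->
  (forall a, f (fp_inl a) = g (fp_inl a)) ->
  (forall b, f (fp_inr b) = g (fp_inr b)) -> f =1 g.
Proof.
move=> hf hg fg1 fg2; elim/qprojW => x.
have hq := @qproj_sam k (fp_free S1 S2) (@fp_rel k S1 S2).
apply: (freeSA_ext (sam_comp hf hq) (sam_comp hg hq)) => -[p s] /=.
rewrite -hcomp_letter (samH hq) (samH hf) (samH hg); congr (hcomp p _).
by case: s => [a|b]; [apply: fg1 | apply: fg2].
Qed.

Variables (f : S1 -> B) (g : S2 -> B).

(** Taking the component of parity [l.1] makes generators go to homogeneous elements, while the two
    generators of one letter still add up to the full image. *)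
Definition fp_letter_val (l : bool * (S1 + S2)) : B :=
  hcomp l.1 (match l.2 with inl a => f a | inr b => g b end).

Definition freeprod_lift : freeprod S1 S2 -> B :=
  quot_lift (free_lift fp_letter_val).

Hypotheses (hf : sa_morph f) (hg : sa_morph g).

Let lift_sam : sa_morph (free_lift fp_letter_val : fp_free S1 S2 -> B).
Proof. by apply: free_liftP => -[p s]; apply: homog_hcomp. Qed.

Let lift_letter s : free_lift fp_letter_val (letter s) =
  match s with inl a => f a | inr b => g b end.
Proof.
by rewrite /letter (samD lift_sam) !free_lift_gen /fp_letter_val /= hcomp_sum.
Qed.

Let lift_rel x y : @fp_rel k S1 S2 x y ->
  free_lift fp_letter_val x = free_lift fp_letter_val y.
Proof.
have L := lift_letter; have hl := lift_sam.
case=> -[a b|c a||a b|p a].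
- rewrite [RHS](samD hl) !L; exact: samD hf _ _.
- rewrite (samZ hl) !L; exact: samZ hf _ _.
- rewrite (sam1 hl) !L; exact: sam1 hf.
- rewrite (samM hl) !L; exact: samM hf _ _.
- rewrite (samH hl) !L; exact: samH hf _ _.
- rewrite [RHS](samD hl) !L; exact: samD hg _ _.
- rewrite (samZ hl) !L; exact: samZ hg _ _.
- rewrite (sam1 hl) !L; exact: sam1 hg.
- rewrite (samM hl) !L; exact: samM hg _ _.
- rewrite (samH hl) !L; exact: samH hg _ _.
Qed.

Lemma freeprod_liftP : sa_morph freeprod_lift.
Proof. exact: quot_liftP. Qed.

Lemma freeprod_lift_inl a : freeprod_lift (fp_inl a) = f a.
Proof. by rewrite /freeprod_lift quot_lift_proj // lift_letter. Qed.

Lemma freeprod_lift_inr b : freeprod_lift (fp_inr b) = g b.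
Proof. by rewrite /freeprod_lift quot_lift_proj // lift_letter. Qed.

End FreeProductLift.

(** * Signs, linear and bilinear maps *)

Lemma sgnK (k : comPzRingType) p q : sgn k p q * sgn k p q = 1.
Proof. by rewrite /sgn -expr2 sqrr_sign. Qed.

Lemma sgnC (k : comPzRingType) p q : sgn k p q = sgn k q p.
Proof. by rewrite /sgn andbC. Qed.

Lemma sgn_addr (k : comPzRingType) p q r :
  sgn k p (q (+) r) = sgn k p q * sgn k p r.
Proof. by case: p q r => [] [] []; rewrite /sgn /= ?expr1 ?mulrNN ?mulr1 ?mul1r. Qed.

Record is_lin (k : comPzRingType) (V W : lmodType k) (f : V -> W) : Prop :=
  IsLin {
  linD : forall x y, f (x + y) = f x + f y;
  linZ : forall c x, f (c *: x) = c *: f x }.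

Lemma lin0 (k : comPzRingType) (V W : lmodType k) (f : V -> W) : is_lin f -> f 0 = 0.
Proof. by move=> hf; rewrite -(scale0r (0 : V)) linZ // scale0r. Qed.

Section Linear.
Variables (k : comPzRingType) (A B V : lmodType k).

Lemma tlift_lin (f : A -> B -> V) : is_bilin f -> is_lin (tlift f).
Proof. by move=> hf; split=> [|c]; [apply: tliftD | apply: tliftZ]. Qed.

Lemma tens_lin_eq (f g : tensor A B -> V) : is_lin f -> is_lin g ->
  (forall a b, f (tpure a b) = g (tpure a b)) -> f =1 g.
Proof.
move=> hf hg fg; elim/tens_ind' => //.
- by rewrite (lin0 hf) (lin0 hg).
- by move=> x y hx hy; rewrite (linD hf) (linD hg) hx hy.
- by move=> c x hx; rewrite (linZ hf) (linZ hg) hx.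
Qed.

End Linear.

Lemma lin_homog_eq (k : comPzRingType) (A : superAlgType k) (V : lmodType k)
    (f g : A -> V) : is_lin f -> is_lin g ->
  (forall p a, homog p a -> f a = g a) -> f =1 g.
Proof.
move=> hf hg fg a; rewrite -[a]hcomp_sum (linD hf) (linD hg).
by congr (_ + _); apply: fg; apply: homog_hcomp.
Qed.

Lemma sam_lin (k : comPzRingType) (S B : superAlgType k) (f : S -> B) :
  sa_morph f -> is_lin f.
Proof. by case. Qed.

Lemma lin_comp (k : comPzRingType) (U V W : lmodType k) (g : V -> W)
    (f : U -> V) : is_lin g -> is_lin f -> is_lin (fun x => g (f x)).
Proof.
move=> hg hf.
by split=> *; rewrite ?(linD hf) ?(linZ hf) ?(linD hg) ?(linZ hg).
Qed.

Lemma mull_lin (k : comPzRingType) (B : superAlgType k) (y : B) :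
  is_lin (fun x : B => y * x : B).
Proof. by split=> *; [apply: mulrDr | apply: superAr]. Qed.

Lemma mulr_lin (k : comPzRingType) (B : superAlgType k) (y : B) :
  is_lin (fun x : B => x * y : B).
Proof. by split=> *; [apply: mulrDl | apply: superAl]. Qed.

Lemma mul_bil (k : comPzRingType) (V W : lmodType k) (B : superAlgType k)
    (f : V -> B) (g : W -> B) : is_lin f -> is_lin g ->
  is_bilin (fun a b => f a * g b).
Proof.
move=> hf hg; split=> *; rewrite ?(linD hf) ?(linZ hf) ?(linD hg) ?(linZ hg).
- exact: mulrDl.
- exact: mulrDr.
- exact: superAl.
- exact: superAr.
Qed.

(** * Tensor powers *)

Section TensorPure.
Variables (k : comPzRingType) (A B : superAlgType k).
Implicit Types (a : A) (b : B).

Lemma tpureM p q a' b a b' : homog p a -> homog q b ->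
  (tpure a' b : tensor A B) * tpure a b' = sgn k p q *: tpure (a' * a) (b * b').
Proof. exact: tmulE. Qed.

Lemma tpure_linl b : is_lin (fun a => tpure a b : tensor A B).
Proof. by split=> *; cbv beta; rewrite ?tpureDl ?tpureZl. Qed.

Lemma tpure_linr a : is_lin (tpure a : B -> tensor A B).
Proof. by split=> *; cbv beta; rewrite ?tpureDr ?tpureZr. Qed.

(** The inner factor [1] is even, so the sign in [tpureM] is trivial, and linearity in [a] removes
    the homogeneity assumption. *)
Lemma tpureM1 a' a b' :
  (tpure a' (1 : B) : tensor A B) * tpure a b' = tpure (a' * a) b'.
Proof.
move: a; apply: lin_homog_eq.
- by split=> *; cbv beta; rewrite ?tpureDl ?tpureZl ?mulrDr ?superAr.
- by split=> *; cbv beta; rewrite ?mulrDr ?superAr ?tpureDl ?tpureZl.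
- by move=> p a ha; rewrite (tpureM _ _ ha (homog1 B)) mul1r /sgn andbF scale1r.
Qed.

Lemma tpure1M a' b b' :
  (tpure a' b : tensor A B) * tpure (1 : A) b' = tpure a' (b * b').
Proof.
move: b; apply: lin_homog_eq.
- by split=> *; cbv beta; rewrite ?tpureDr ?tpureZr ?mulrDl ?superAl.
- by split=> *; cbv beta; rewrite ?mulrDl ?superAl ?tpureDr ?tpureZr.
- by move=> q b hb; rewrite (tpureM _ _ (homog1 A) hb) mulr1 scale1r.
Qed.

Lemma hcomp_tpure p a b : hcomp p (tpure a b : tensor A B) =
  tpure (hcomp false a) (hcomp p b) + tpure (hcomp true a) (hcomp (~~ p) b).
Proof.
transitivity (thcomp p (tpure a b)) => //.
by rewrite /thcomp (tlift_pure (thcomp_bil A B p)) sum_bool addbF addbT.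
Qed.

Lemma tpure_saml : sa_morph (fun a => tpure a (1 : B) : tensor A B).
Proof.
split=> [x y|c x||x y|p x].
- exact: tpureDl.
- exact: tpureZl.
- by [].
- by rewrite tpureM1.
- rewrite hcomp_tpure !(homog_neq _ (homog1 B)).
  by case: p; rewrite /= tpure0r ?addr0 ?add0r.
Qed.

Lemma tpure_samr : sa_morph (fun b => tpure (1 : A) b : tensor A B).
Proof.
split=> [x y|c x||x y|p x].
- exact: tpureDr.
- exact: tpureZr.
- by [].
- by rewrite tpure1M.
- by rewrite hcomp_tpure !(homog_neq _ (homog1 A)) /= tpure0l addr0.
Qed.

End TensorPure.

Section TensorPowerAt.
Variables (k : comPzRingType) (A : superAlgType k).

Lemma tpow_at_last m (a : A) : tpow_at m.+1 m a = tpure a (1 : tpow A m).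
Proof. by rewrite /= eqxx. Qed.

Lemma tpow_at_lt m i (a : A) : (i < m)%N ->
  tpow_at m.+1 i a = tpure (1 : A) (tpow_at m i a).
Proof. by move=> h; rewrite /= ltn_eqF. Qed.

Lemma ltnS_case m i : (i < m.+1)%N -> i = m \/ (i < m)%N.
Proof. by rewrite ltnS leq_eqVlt => /orP[/eqP ->|]; [left | right]. Qed.

Lemma tpow_at_sam n i : (i < n)%N -> sa_morph (tpow_at n i : A -> tpow A n).
Proof.
elim: n => // m IH /ltnS_case[->|h].
  have -> : tpow_at m.+1 m = (fun a => tpure a (1 : tpow A m))
      :> (A -> tensor A (tpow A m)).
    by rewrite /= eqxx.
  exact: tpure_saml.
have -> : tpow_at m.+1 i = tpure (1 : A) \o tpow_at m i :> (A -> tensor A (tpow A m)).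
  by rewrite /= ltn_eqF.
exact: (sam_comp (tpure_samr _ _) (IH h)).
Qed.

Lemma tpow_at_comm n i j p q (a b : A) : (i < n)%N -> (j < n)%N -> i != j ->
  homog p a -> homog q b ->
  tpow_at n i a * tpow_at n j b =
  sgn k p q *: (tpow_at n j b * tpow_at n i a).
Proof.
move=> + + + ha hb; elim: n => // m IH.
(* Signs arise here only when one of the two elements sits in the leftmost factor; otherwise both
   lie in [tpow A m]. *)
have sw l r (x y : A) : (l < m)%N -> homog r y -> forall s, homog s x ->
    tpow_at m.+1 l y * tpow_at m.+1 m x =
    sgn k s r *: (tpow_at m.+1 m x * tpow_at m.+1 l y).
  move=> hl hy s hx; rewrite tpow_at_last (tpow_at_lt _ hl).
  rewrite (tpureM _ _ hx (sam_homog (tpow_at_sam hl) hy)) tpureM1.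
  by rewrite mul1r !mulr1.
move=> /ltnS_case[->|hi] /ltnS_case[->|hj] ij.
- by rewrite eqxx in ij.
- by rewrite (sw _ _ _ _ hj hb _ ha) scalerA sgnK scale1r.
- by rewrite (sw _ _ _ _ hi ha _ hb) sgnC.
- by rewrite !tpow_at_lt // !tpure1M IH // tpureZr.
Qed.

(** A pure tensor of [a] and [t] is the product of [a] in the leftmost factor and [t] in the others,
    so the elements concentrated in one factor generate the tensor power. *)
Lemma tpow_ext (B : superAlgType k) n (f g : tpow A n -> B) :
  sa_morph f -> sa_morph g ->
  (forall i a, (i < n)%N -> f (tpow_at n i a) = g (tpow_at n i a)) -> f =1 g.
Proof.
elim: n f g => [|m IH] f g hf hg fg.
  move=> c; have -> : c = (c : k) *: (1 : baseSA k) by rewrite -[RHS]/(_ * _) mulr1.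
  by rewrite (samZ hf) (samZ hg) (sam1 hf) (sam1 hg).
apply: tens_lin_eq; [exact: sam_lin hf | exact: sam_lin hg | move=> a t].
rewrite -[a]mulr1 -tpureM1 (samM hf) (samM hg); congr (_ * _).
  by rewrite -tpow_at_last fg.
apply: (IH (f \o tpure (1 : A)) (g \o tpure (1 : A))).
- exact: (sam_comp hf (tpure_samr _ _)).
- exact: (sam_comp hg (tpure_samr _ _)).
- by move=> i b hi /=; rewrite -tpow_at_lt // fg // ltnW.
Qed.

Lemma tmapr_bil (M N : lmodType k) (f : M -> N) : is_lin f ->
  is_bilin (fun (a : A) m => tpure a (f m)).
Proof.
move=> hf; split=> *; cbv beta.
all: by rewrite ?(linD hf) ?(linZ hf) ?(tpureDl, tpureDr, tpureZl, tpureZr).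
Qed.

Lemma tmapr_pure (M N : lmodType k) (f : M -> N) (a : A) m : is_lin f ->
  tmapr f (tpure a m) = tpure a (f m).
Proof. by move=> hf; rewrite /tmapr (tlift_pure (tmapr_bil hf)). Qed.

Section Swap.
Variable M : lmodType k.

Let sw (a b : A) (m : M) : tensor A (tensor A M) :=
  \sum_(p : bool) \sum_(q : bool)
    sgn k p q *: tpure (hcomp q b) (tpure (hcomp p a) m).

Let sw_bil a : is_bilin (sw a).
Proof.
split=> *; cbv beta; rewrite /sw ?scaler_sumr -?big_split; apply: eq_bigr => p _;
  rewrite ?scaler_sumr -?big_split; apply: eq_bigr => q _.
- by rewrite hcompD tpureDl scalerDr.
- by rewrite !tpureDr scalerDr.
- by rewrite hcompZ tpureZl !scalerA mulrC.
- by rewrite !tpureZr !scalerA mulrC.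
Qed.

Let sw_bil2 : is_bilin (fun a => tlift (sw a)).
Proof.
have L x := tlift_lin (sw_bil x).
split=> [a a' x|a x x'|c a x|c a x]; rewrite ?(linD (L _)) ?(linZ (L _)) //.
- move: x; apply: tens_lin_eq => [||b m]; first exact: L.
    split=> *; cbv beta; rewrite ?(linD (L _)) ?(linZ (L _)) ?scalerDr //.
    by rewrite addrACA.
  rewrite !(tlift_pure (sw_bil _)) /sw -big_split; apply: eq_bigr => p _.
  rewrite -big_split; apply: eq_bigr => q _.
  by rewrite hcompD tpureDl tpureDr scalerDr.
- move: x; apply: tens_lin_eq => [||b m]; first exact: L.
    split=> *; cbv beta; rewrite ?(linD (L _)) ?(linZ (L _)) ?scalerDr //.
    by rewrite !scalerA mulrC.
  rewrite !(tlift_pure (sw_bil _)) /sw scaler_sumr; apply: eq_bigr => p _.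
  rewrite scaler_sumr; apply: eq_bigr => q _.
  by rewrite hcompZ tpureZl tpureZr !scalerA mulrC.
Qed.

Lemma tswap_lin : is_lin (@tswap k A M).
Proof. exact: (tlift_lin sw_bil2). Qed.

Lemma tswap_pure p q (a b : A) (m : M) : homog p a -> homog q b ->
  tswap (tpure a (tpure b m)) = sgn k p q *: tpure b (tpure a m).
Proof.
move=> ha hb; rewrite /tswap (tlift_pure sw_bil2) (tlift_pure (sw_bil a)) /sw.
have Z1 x : tpure (0 : A) x = 0 :> tensor A (tensor A M).
  exact: (lin0 (f := fun a => tpure a x)
    (IsLin (fun a a' => tpureDl a a' x) (fun c a => tpureZl c a x))).
have Z2 : tpure (0 : A) m = 0 :> tensor A M.
  exact: (lin0 (f := fun a => tpure a m)
    (IsLin (fun a a' => tpureDl a a' m) (fun c a => tpureZl c a m))).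
have Z3 x : tpure x 0 = 0 :> tensor A (tensor A M).
  exact: (lin0 (IsLin (fun a a' => tpureDr x a a') (fun c a => tpureZr c x a))).
rewrite !sum_bool !(homog_neq _ ha) !(homog_neq _ hb).
by case: p q {ha hb} => [] [];
  rewrite /= ?(Z2, Z1, Z3, scaler0, addr0, add0r).
Qed.

End Swap.

Lemma sactSS l i : sact l.+2 i =
  (if i == l then @tswap k A (tpow A l) else tmapr (sact l.+1 i))
  :> (tpow A l.+2 -> tpow A l.+2).
Proof. by []. Qed.

Lemma sact_lin n i : is_lin (sact n i : tpow A n -> tpow A n).
Proof.
elim: n => [|[|l] IH] //; rewrite sactSS; case: eqP => _; first exact: tswap_lin.
exact: (tlift_lin (tmapr_bil IH)).
Qed.

Definition swap_index i j := if j == i then i.+1 else if j == i.+1 then i else j.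

Lemma sact_1 n i : (i.+1 < n)%N -> sact n i (1 : tpow A n) = 1.
Proof.
elim: n => [|[|l] IH] // hi; rewrite sactSS.
case: eqP => [_|/eqP il].
  rewrite -[1]/(tpure (1 : A) (tpure (1 : A) (1 : tpow A l))).
  by rewrite (tswap_pure _ (homog1 A) (homog1 A)) scale1r.
rewrite -[1]/(tpure (1 : A) (1 : tpow A l.+1)) tmapr_pure ?IH //; first by lia.
exact: (sact_lin l.+1 i).
Qed.

(** All other factors are the even element 1, hence no sign. This turns the relation [nr_slide] into
    the slide rule for single tokens. *)
Lemma sact_at n i j (a : A) : (i.+1 < n)%N -> (j < n)%N ->
  sact n i (tpow_at n j a) = tpow_at n (swap_index i j) a.
Proof.
rewrite /swap_index; elim: n => [|[|l] IH] // hi hj; rewrite sactSS.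
have h1 := homog1 A.
have one : (1 : tpow A l.+1) = tpure (1 : A) (1 : tpow A l) by [].
have linl := sact_lin l.+1 i.
case: eqP => [il|/eqP il].
  subst i; clear IH; move: a; apply: lin_homog_eq.
  - have hs := sam_lin (tpow_at_sam hj); have ht := tswap_lin (tpow A l).
    by split=> *; cbv beta; rewrite ?(linD hs) ?(linZ hs) ?(linD ht) ?(linZ ht).
  - by apply/sam_lin/tpow_at_sam; do 2?case: eqP => *; lia.
  move=> p a ha.
  have [jl|jl] := eqVneq j l.
    rewrite jl tpow_at_lt // !tpow_at_last one (tswap_pure _ h1 ha).
    by rewrite scale1r.
  have [jl'|jl'] := eqVneq j l.+1.
    rewrite jl' tpow_at_last one (tswap_pure _ ha h1) tpow_at_lt //.
    by rewrite tpow_at_last /sgn andbF scale1r.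
  have hj' : (j < l)%N by lia.
  rewrite tpow_at_lt; last by lia.
  by rewrite tpow_at_lt // (tswap_pure _ h1 h1) scale1r.
have [jl|jl] := eqVneq j l.+1.
  rewrite jl !ifF; try lia.
  by rewrite tpow_at_last tmapr_pure // sact_1 //; lia.
rewrite tpow_at_lt; last by lia.
rewrite tmapr_pure // IH; try lia.
rewrite -tpow_at_lt //; case: ifP => [/eqP|] *; try lia.
case: ifP => *; lia.
Qed.

End TensorPowerAt.

(** * The universal property of the tensor power *)

Section TensorPowerLift.
Variables (k : comPzRingType) (A B : superAlgType k) (T : nat -> A -> B).

(** The images are multiplied in the order of the tensor factors, highest strand on the left. The
    family [T] is indexed by all of [nat] and constrained only below [N], so the recursion on [n]
    keeps a single family. *)
Fixpoint tpow_lift n : tpow A n -> B :=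
  match n return tpow A n -> B with
  | 0 => fun c => (c : k) *: (1 : B)
  | m.+1 => tlift (fun a t => T m a * tpow_lift t)
  end.

Variable N : nat.
Hypothesis Tsam : forall i, (i < N)%N -> sa_morph (T i).

Lemma tpow_lift_lin n : (n <= N)%N -> is_lin (@tpow_lift n).
Proof.
elim: n => [|m IH] hn.
  by split=> [c d|c d]; cbv beta; rewrite /= ?scalerDl ?scalerA.
exact: tlift_lin (mul_bil (sam_lin (Tsam hn)) (IH (ltnW hn))).
Qed.

Lemma tpow_lift_pure m (a : A) (t : tpow A m) : (m < N)%N ->
  tpow_lift (tpure a t : tpow A m.+1) = T m a * tpow_lift t.
Proof.
move=> hm.
exact: (tlift_pure (mul_bil (sam_lin (Tsam hm)) (tpow_lift_lin (ltnW hm)))).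
Qed.

Lemma tpow_lift_1 n : (n <= N)%N -> tpow_lift (1 : tpow A n) = 1.
Proof.
elim: n => [|m IH] hn; first exact: scale1r.
rewrite -[1 in LHS]/(tpure (1 : A) (1 : tpow A m)) tpow_lift_pure //.
by rewrite IH ?(sam1 (Tsam hn)) ?mulr1 1?ltnW.
Qed.

Lemma tpow_lift_hcomp n p (t : tpow A n) : (n <= N)%N ->
  tpow_lift (hcomp p t) = hcomp p (tpow_lift t).
Proof.
elim: n p t => [|m IH] p t hn.
  rewrite [RHS]hcompZ (homog_neq _ (homog1 B)).
  by case: p; rewrite /= ?scaler0 ?scale0r.
have hT := Tsam hn; have hL := tpow_lift_lin hn.
move: t; apply: tens_lin_eq => [||a t].
- by split=> *; cbv beta; rewrite ?hcompD ?hcompZ ?(linD hL) ?(linZ hL).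
- by split=> *; cbv beta; rewrite ?(linD hL) ?(linZ hL) ?hcompD ?hcompZ.
- rewrite hcomp_tpure (linD hL) !tpow_lift_pure // hcompM.
  by rewrite !(samH hT) !IH // ltnW.
Qed.

(** Passing [y] through the factors one by one multiplies the signs, which combine by [sgn_addr]. *)
Lemma tpow_lift_comm n p (y : B) : (n <= N)%N ->
  (forall i q a, (i < n)%N -> homog q a -> y * T i a = sgn k p q *: (T i a * y)) ->
  forall q t, homog q t ->
    y * tpow_lift (t : tpow A n) = sgn k p q *: (tpow_lift t * y).
Proof.
elim: n => [|m IH] hn hy q t ht.
  (* The empty tensor power is purely even, so its odd elements vanish. *)
  have [e|e] := eqVneq q false.
    by rewrite e /sgn andbF scale1r /= superAl superAr mul1r mulr1.
  have -> : t = 0 by rewrite -ht; case: (q) e.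
  by rewrite /= !scale0r mulr0 mul0r scaler0.
have hL := tpow_lift_lin hn; rewrite -{}ht.
elim/tens_indh: t => [p1 q1 a t ha ht||x x' hx hx'|c x hx].
- rewrite (_ : hcomp q _ = thcomp q (tpure a t)) // (thcompE _ ha ht).
  case: eqP => [->|_]; last by rewrite (lin0 hL) mulr0 mul0r scaler0.
  rewrite tpow_lift_pure // mulrA (hy _ _ _ _ ha) // superAl -mulrA.
  rewrite (IH _ _ _ _ ht) ?(ltnW hn) //; last first.
    by move=> i r b hi; apply: hy; apply: leqW.
  by rewrite superAr scalerA mulrA sgn_addr.
- by rewrite hcomp0 (lin0 hL) mulr0 mul0r scaler0.
- by rewrite hcompD (linD hL) mulrDr mulrDl hx hx' scalerDr.
- by rewrite hcompZ (linZ hL) superAr superAl hx !scalerA mulrC.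
Qed.

Lemma tpow_lift_comm_even n (y : B) : (n <= N)%N ->
  (forall i a, (i < n)%N -> y * T i a = T i a * y) ->
  forall t, y * tpow_lift (t : tpow A n) = tpow_lift t * y.
Proof.
move=> hn hy; have hL := tpow_lift_lin hn; apply: lin_homog_eq.
- by split=> *; cbv beta; rewrite ?(linD hL) ?(linZ hL) ?mulrDr ?superAr.
- by split=> *; cbv beta; rewrite ?(linD hL) ?(linZ hL) ?mulrDl ?superAl.
- move=> q t /(@tpow_lift_comm n false y hn) ->; first by rewrite scale1r.
  by move=> i r a hi _; rewrite scale1r hy.
Qed.

Lemma tpow_lift_at n i a : (n <= N)%N -> (i < n)%N ->
  tpow_lift (tpow_at n i a) = T i a.
Proof.
elim: n => // m IH hn /ltnS_case[->|h].
  by rewrite tpow_at_last tpow_lift_pure // tpow_lift_1 ?mulr1 // ltnW.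
rewrite tpow_at_lt // tpow_lift_pure // IH ?(ltnW hn) //.
by rewrite (sam1 (Tsam hn)) mul1r.
Qed.

Hypothesis Tcomm : forall i j p q a b, (i < N)%N -> (j < N)%N -> i != j ->
  homog p a -> homog q b -> T i a * T j b = sgn k p q *: (T j b * T i a).

Lemma tpow_liftP n : (n <= N)%N -> sa_morph (@tpow_lift n).
Proof.
move=> hn; have [hD hZ] := tpow_lift_lin hn.
split=> // [||p x]; [exact: tpow_lift_1 | | exact: tpow_lift_hcomp].
elim: n hn hD hZ => [|m IH] hn hD hZ.
  by move=> c d; rewrite /= superAl mul1r scalerA.
have hL := IsLin hD hZ; have hLm := tpow_lift_lin (ltnW hn).
have hT := Tsam hn.
have hM x y : tpow_lift (x * y : tpow A m) = tpow_lift x * tpow_lift y.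
  by case: hLm => *; apply: IH => //; apply: ltnW.
move=> x y.
elim/tens_indh: x => [p1 q1 a1 b1 ha1 hb1||x x' hx hx'|c x hx].
- elim/tens_indh: y => [p2 q2 a2 b2 ha2 hb2||y y' hy hy'|c y hy].
  (* The sign of [tpureM] cancels the one that arises when [T m a2] moves past the image of [b1],
     which involves only strands below [m]. *)
  + rewrite (tpureM _ _ ha2 hb1) hZ !tpow_lift_pure // (samM hT) hM.
    rewrite -!mulrA -superAr; congr (_ * _); rewrite !mulrA -superAl.
    congr (_ * _); rewrite (tpow_lift_comm (ltnW hn) _ hb1 (p := p2)).
      by rewrite scalerA sgnK scale1r.
    by move=> i q b hi hb; apply: Tcomm => //; [apply: ltn_trans hn | rewrite gtn_eqF].
  + by rewrite !(mulr0, lin0 hL).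
  + by rewrite !(mulrDr, hD) hy hy'.
  + by rewrite !(superAr, hZ) hy.
- by rewrite !(mul0r, lin0 hL).
- by rewrite !(mulrDl, hD) hx hx'.
- by rewrite !(superAl, hZ) hx.
Qed.

(** Extends the slide rule from tokens to arbitrary tensors. Induction on [n] strips leftmost
    factors until the crossed strands are the two highest; the remaining tensor then lies on strands
    whose tokens commute with [y]. *)
Lemma tpow_lift_slide n i (y : B) : (n <= N)%N -> (i.+1 < n)%N ->
  (forall j a, (j < n)%N -> y * T j a = T (swap_index i j) a * y) ->
  forall t, y * tpow_lift (t : tpow A n) = tpow_lift (sact n i t) * y.
Proof.
elim: n => [|[|l] IH] // hn hi hy.
have hL := tpow_lift_lin hn; have hs := sact_lin A l.+2 i.
rewrite /swap_index in hy.
apply: tens_lin_eq => [||a t].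
- exact: lin_comp (mull_lin y) hL.
- exact: lin_comp (mulr_lin y) (lin_comp hL hs).
move: hs; rewrite sactSS; case: eqP => [il|/eqP il] hs; last first.
  have hs' := sact_lin A l.+1 i.
  rewrite tmapr_pure // !tpow_lift_pure // mulrA hy // !ifF; try lia.
  rewrite -!mulrA; congr (_ * _); apply: IH; [lia | lia |].
  by move=> j b hj; rewrite hy //; lia.
have hl : (l < N)%N by lia.
have hl2 := ltnW hn; rewrite {}il {IH hi} in hy *.
(* Linearity of both sides in each variable reduces the claim to a pure tensor with its two leftmost
   entries [a] and [b] homogeneous, where [tswap] has an explicit sign. *)
have hsL := lin_comp (mulr_lin y) (lin_comp hL hs).
have hyL := lin_comp (mull_lin y) hL.
have rl := @tpure_linr k A (tpow A l.+1); have ll := @tpure_linl k A (tpow A l.+1).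
have ll' := @tpure_linl k A (tpow A l).
have hya := lin_comp hyL (rl a); have hsa := lin_comp hsL (rl a).
move: t; apply: (tens_lin_eq hya hsa) => b t.
have hyb := lin_comp hyL (ll (tpure b t)); have hsb := lin_comp hsL (ll (tpure b t)).
move: a {hya hsa}; apply: (lin_homog_eq hyb hsb) => p a ha.
have hyc := lin_comp (lin_comp hyL (rl a)) (ll' t).
have hsc := lin_comp (lin_comp hsL (rl a)) (ll' t).
move: b {hyb hsb}; apply: (lin_homog_eq hyc hsc) => q b hb.
rewrite (tswap_pure _ ha hb) (linZ hL) !tpow_lift_pure //.
rewrite !mulrA hy // ifF ?eqxx; last by lia.
rewrite -!mulrA [y * _]mulrA hy // eqxx -!mulrA.
rewrite (@tpow_lift_comm_even l) ?(ltnW hl) //; last first.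
  by move=> j c hj; rewrite hy ?ifF //; lia.
(* Sliding leaves the two tokens in the opposite order to [tpow_lift]; exchanging them produces
   exactly the sign of [tswap]. *)
rewrite !mulrA superAl (Tcomm _ _ _ ha hb) //; last by lia.
by rewrite !superAl.
Qed.

End TensorPowerLift.

(** * NilCoxeter families *)

(** Strands are bounded natural numbers rather than ordinals, so that shifts of strands under tensor
    products need no transport. *)
Record nilcox_family (k : comPzRingType) (A B : superAlgType k) (N : nat)
    (T : nat -> A -> B) (U : nat -> B) : Prop := NilcoxFamily {
  ncf_sam : forall i, (i < N)%N -> sa_morph (T i);
  ncf_tok_comm : forall i j p q a b, (i < N)%N -> (j < N)%N -> i != j ->
    homog p a -> homog q b -> T i a * T j b = sgn k p q *: (T j b * T i a);
  ncf_even : forall i, (i.+1 < N)%N -> homog false (U i);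
  ncf_sq : forall i, (i.+1 < N)%N -> U i * U i = 0;
  ncf_comm : forall i j, (i.+1 < j)%N -> (j.+1 < N)%N -> U i * U j = U j * U i;
  ncf_braid : forall i, (i.+2 < N)%N ->
    U i * U i.+1 * U i = U i.+1 * U i * U i.+1;
  ncf_slide : forall i j a, (i.+1 < N)%N -> (j < N)%N ->
    U i * T j a = T (swap_index i j) a * U i }.

Lemma ord_pred_lt n (i : 'I_n.-1) : (i.+1 < n)%N.
Proof. by case: i => i /=; lia. Qed.

(** * Morphisms out of the presented algebra, and its own family *)

Section PresentationLift.
Variables (k : comPzRingType) (A B : superAlgType k) (N : nat).

Lemma pres_ext (f g : nilCoxPres A N -> B) : sa_morph f -> sa_morph g ->
  (forall i, f (pres_u A i) = g (pres_u A i)) ->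
  (forall i a, (i < N)%N ->
    f (pres_in (tpow_at N i a)) = g (pres_in (tpow_at N i a))) -> f =1 g.
Proof.
move=> hf hg fgU fgT; elim/qprojW.
have hq := @qproj_sam k _ (@nilcox_rel k A N).
have hl := @fp_inl_sam k (tpow A N) (evenSA k N).
have hr := @fp_inr_sam k (tpow A N) (evenSA k N).
have hf' := sam_comp hf hq; have hg' := sam_comp hg hq.
apply: (freeprod_ext hf' hg').
- exact: (tpow_ext (sam_comp hf' hl) (sam_comp hg' hl) fgT).
- exact: (freeSA_ext (sam_comp hf' hr) (sam_comp hg' hr) fgU).
Qed.

Lemma pres_in_sam : sa_morph (@pres_in k A N).
Proof.
exact: (sam_comp (@qproj_sam k _ (@nilcox_rel k A N)) (@fp_inl_sam k _ _)).
Qed.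

Variables (T : nat -> A -> B) (U : nat -> B).
Hypothesis fam : nilcox_family N T U.

Let even_lift : evenSA k N -> B := free_lift (fun i : 'I_N.-1 => U i).

Let even_lift_sam : sa_morph even_lift.
Proof. by apply: free_liftP => i; apply: (ncf_even fam); apply: ord_pred_lt. Qed.

Let tpow_sam : sa_morph (@tpow_lift k A B T N).
Proof. exact: (tpow_liftP (ncf_sam fam) (ncf_tok_comm fam)). Qed.

Let fp_lift : nilcox_free A N -> B := freeprod_lift (@tpow_lift k A B T N) even_lift.

Let fp_lift_sam : sa_morph fp_lift.
Proof. exact: freeprod_liftP. Qed.

Let fp_lift_u (i : 'I_N.-1) :
  fp_lift (fp_inr (fgen (fun _ : 'I_N.-1 => false) i : evenSA k N)) = U i.
Proof. by rewrite /fp_lift freeprod_lift_inr // /even_lift free_lift_gen. Qed.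

Let fp_lift_rel x y : nilcox_rel x y -> fp_lift x = fp_lift y.
Proof.
have hM := samM fp_lift_sam.
case=> [i|i j ij|i j ij|i a]; rewrite ?expr2 !hM ?fp_lift_u.
- by rewrite (sam0 fp_lift_sam) (ncf_sq fam) // ord_pred_lt.
- case/orP: ij => ij.
    by rewrite (ncf_comm fam ij (ord_pred_lt j)).
  by rewrite (ncf_comm fam ij (ord_pred_lt i)).
- by rewrite ij (ncf_braid fam) // -ij ord_pred_lt.
- rewrite /fp_lift !freeprod_lift_inl //.
  apply: (tpow_lift_slide (ncf_sam fam) (ncf_tok_comm fam)) => //.
    exact: ord_pred_lt.
  by move=> j b hj; rewrite (ncf_slide fam) // ord_pred_lt.
Qed.

Definition pres_lift : nilCoxPres A N -> B := quot_lift fp_lift.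

Lemma pres_liftP : sa_morph pres_lift.
Proof. exact: quot_liftP. Qed.

Lemma pres_lift_u i : pres_lift (pres_u A i) = U i.
Proof. by rewrite /pres_lift quot_lift_proj // fp_lift_u. Qed.

Lemma pres_lift_at i a : (i < N)%N -> pres_lift (pres_in (tpow_at N i a)) = T i a.
Proof.
move=> hi; rewrite /pres_lift quot_lift_proj // /fp_lift freeprod_lift_inl //.
exact: (tpow_lift_at (ncf_sam fam)).
Qed.

End PresentationLift.

Section PresentationFamily.
Variables (k : comPzRingType) (A : superAlgType k) (N : nat).

Definition pres_tok i (a : A) : nilCoxPres A N := pres_in (tpow_at N i a).
(** The value 0 out of range is a mere default, since families are indexed by [nat]. *)
Definition pres_cross i : nilCoxPres A N :=
  if insub i is Some j then pres_u A j else 0.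

Lemma pres_crossE (i : 'I_N.-1) : pres_cross i = pres_u A i.
Proof. by rewrite /pres_cross valK. Qed.

Lemma pres_family : nilcox_family N pres_tok pres_cross.
Proof.
have hin := @pres_in_sam k A N.
have hq := @qproj_sam k _ (@nilcox_rel k A N).
have R x y := @qproj_rel k _ (@nilcox_rel k A N) x y.
have ordP i : (i.+1 < N)%N -> exists j : 'I_N.-1, i = j.
  by move=> hi; have hi' : (i < N.-1)%N by [lia]; exists (Ordinal hi').
split.
- by move=> i hi; apply: (sam_comp hin (@tpow_at_sam k A N i hi)).
- move=> i j p q a b hi hj ij ha hb; rewrite /pres_tok -!(samM hin) -(samZ hin).
  by rewrite (tpow_at_comm hi hj ij ha hb).
- move=> _ /ordP[i ->]; rewrite pres_crossE.
  apply: (sam_homog hq); apply: (sam_homog (@fp_inr_sam k _ _)).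
  by rewrite /homog free_hcompE.
- move=> _ /ordP[i ->]; rewrite pres_crossE -(samM hq) -(sam0 hq).
  exact: R (nr_sq _ i).
- move=> i j ij hj; have [i' ei] := ordP i ltac:(lia); have [j' ej] := ordP j hj.
  have ij' : (i'.+1 < j')%N || (j'.+1 < i')%N by rewrite -ei -ej ij.
  by rewrite ei ej !pres_crossE -!(samM hq); apply: (R _ _ (nr_comm A ij')).
- move=> i hi; have [i' ei] := ordP i ltac:(lia); have [j' ej] := ordP i.+1 hi.
  have ij : j' = i'.+1 :> nat by rewrite -ei -ej.
  by rewrite ej ei !pres_crossE; have := R _ _ (nr_braid A ij); rewrite !(samM hq).
- move=> _ j a /ordP[i ->] hj; rewrite pres_crossE /pres_tok -sact_at //.
    by rewrite -!(samM hq); apply: (R _ _ (nr_slide i _)).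
  exact: ord_pred_lt.
Qed.

End PresentationFamily.

(** * Evaluation of morphisms in a nilCoxeter family *)

Section MorphismValue.
Variables (k : comPzRingType) (A B : superAlgType k) (N : nat).
Variables (T : nat -> A -> B) (U : nat -> B).

(* The value of a morphism drawn on the strands i, i+1, ... of I^(x)N.  The
   types need not match up: a morphism m -> n with m <> n is a combination of
   zero morphisms and has value 0. *)
Fixpoint mor_val m n (f : mor A m n) (i : nat) : B :=
  match f with
  | mId _ => 1
  | mComp _ _ _ f g => mor_val f i * mor_val g i
  | mTens _ _ m' _ f g => mor_val f (i + m') * mor_val g i
  | mX => U i
  | mTok a => T i a
  | mZero _ _ => 0
  | mAdd _ _ f g => mor_val f i + mor_val g i
  | mScale _ _ c f => c *: mor_val f i
  end.

Lemma mor_val_cast m n m' n' (em : m = m') (en : n = n') (f : mor A m n) i :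
  mor_val (mcast em en f) i = mor_val f i.
Proof. by case: m' / em; case: n' / en. Qed.

(** Generators are endomorphisms, so a composite or tensor product with distinct ends has a factor
    with distinct ends. *)
Lemma mor_val_neq m n (f : mor A m n) i : m != n -> mor_val f i = 0.
Proof.
elim: m n / f i => /=.
- by move=> n i; rewrite eqxx.
- move=> l m n f hf g hg i ln; have [e|lm] := eqVneq l m.
    by rewrite hf ?mul0r // -e.
  by rewrite hg ?mulr0.
- move=> m n m' n' f hf g hg i mn; have [e|lm] := eqVneq m n.
    rewrite hg ?mulr0 //; apply: contra mn => /eqP ->; rewrite e //.
  by rewrite hf ?mul0r.
- by [].
- by [].
- by [].
- by move=> m n f hf g hg i mn; rewrite hf // hg // addr0.
- by move=> m n c f hf i mn; rewrite hf // scaler0.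
Qed.

Hypothesis fam : nilcox_family N T U.

Lemma mor_val_homog m n (f : mor A m n) p i : mhomog f p -> (i + m <= N)%N ->
  homog p (mor_val f i).
Proof.
have h0 q : homog q (0 : B) by apply: hcomp0.
elim: m n / f p i => /=.
- by move=> n p i -> _; apply: homog1.
- move=> l m n f hf g hg p i [q [fq gq]] hi.
  have [e|lm] := eqVneq l m; last by rewrite (mor_val_neq g) ?mulr0.
  rewrite (_ : p = q (+) (p (+) q)); last by case: (p) (q) => [] [].
  by apply: homogM; [apply: hf => //; rewrite -e | apply: hg].
- move=> m n m' n' f hf g hg p i [q [fq gq]] hi.
  rewrite (_ : p = q (+) (p (+) q)); last by case: (p) (q) => [] [].
  by apply: homogM; [apply: hf => //; lia | apply: hg => //; lia].
- by move=> p i -> hi; apply: (ncf_even fam); lia.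
- by move=> a p i ha hi; apply: (sam_homog (ncf_sam fam _)) => //; lia.
- by [].
- move=> m n f hf g hg p i [fp gp] hi.
  by rewrite /homog hcompD hf // hg.
- by move=> m n c f hf p i fp hi; rewrite /homog hcompZ hf.
Qed.

Lemma mor_val_comm_gen y q m n (f : mor A m n) p i :
  mhomog f p -> (i + m <= N)%N ->
  (forall l r a, (i <= l < i + m)%N -> homog r a ->
    y * T l a = sgn k q r *: (T l a * y)) ->
  (forall l, (i <= l)%N -> (l.+1 < i + m)%N -> y * U l = U l * y) ->
  y * mor_val f i = sgn k q p *: (mor_val f i * y).
Proof.
elim: m n / f p i => /=.
- by move=> n p i -> *; rewrite /sgn andbF scale1r mulr1 mul1r.
- move=> l m n f hf g hg p i [r [fr gr]] hi hT hU.
  have [e|lm] := eqVneq l m; last first.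
    by rewrite (mor_val_neq g) ?mulr0 ?mul0r ?scaler0 ?mulr0.
  subst m; rewrite mulrA (hf _ _ fr) // superAl -mulrA (hg _ _ gr) //.
  rewrite superAr scalerA mulrA -sgn_addr.
  by rewrite (_ : r (+) (p (+) r) = p) //; case: (p) (r) => [] [].
- move=> m n m' n' f hf g hg p i [r [fr gr]] hi hT hU.
  rewrite mulrA (hf _ _ fr); first 1 [rewrite superAl -mulrA (hg _ _ gr)]; try lia.
  + rewrite superAr scalerA mulrA -sgn_addr.
    by rewrite (_ : r (+) (p (+) r) = p) //; case: (p) (r) => [] [].
  + by move=> l s a hl; apply: hT; lia.
  + by move=> l hl hl'; apply: hU; lia.
  + by move=> l s a hl; apply: hT; lia.
  + by move=> l hl hl'; apply: hU; lia.
- by move=> p i -> hi hT hU; rewrite /sgn andbF scale1r hU //; lia.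
- by move=> a p i ha hi hT hU; rewrite (hT _ p) //; lia.
- by move=> m n p i *; rewrite mulr0 mul0r scaler0.
- move=> m n f hf g hg p i [fp gp] hi hT hU.
  by rewrite mulrDr mulrDl (hf p) // (hg p) // scalerDr.
- move=> m n c f hf p i fp hi hT hU.
  by rewrite superAr superAl (hf p) // !scalerA mulrC.
Qed.

Lemma mor_val_comm m n m' n' (f : mor A m n) (g : mor A m' n') p q i j :
  mhomog f p -> mhomog g q -> (i + m <= j)%N -> (j + m' <= N)%N ->
  mor_val f i * mor_val g j = sgn k p q *: (mor_val g j * mor_val f i).
Proof.
move=> fp gq hij hj.
have flip (y z : B) r s : y * z = sgn k s r *: (z * y) ->
    z * y = sgn k r s *: (y * z).
  by move=> ->; rewrite scalerA sgnC sgnK scale1r.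
(* [mor_val_comm_gen] is applied in each variable: the value of [f] is moved past the generators of
   [g], and for each of these past the generators of [f]. *)
apply: mor_val_comm_gen gq (hj) _ _ => l.
- move=> r a hl ha; apply: flip; apply: mor_val_comm_gen fp _ _ _; first by lia.
    by move=> s t b hs hb; apply: (ncf_tok_comm fam) => //; lia.
  move=> s hs hs'; rewrite (ncf_slide fam); try lia.
  by rewrite /swap_index !ifF //; lia.
- move=> hl hl'; apply/esym; rewrite -[RHS]scale1r -[1]/(sgn k false p).
  apply: mor_val_comm_gen fp _ _ _; first by lia.
    move=> s r a hs ha; rewrite scale1r (ncf_slide fam); try lia.
    by rewrite /swap_index !ifF //; lia.
  by move=> s hs hs'; rewrite -(ncf_comm fam) //; lia.
Qed.

(** Evaluation respects all axioms of the category, so it descends to morphisms. The bound on [i]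
    keeps every generator that matters within the [N] strands on which the family relations hold. *)
Lemma mor_valP m n (f g : mor A m n) : mor_eq f g ->
  forall i, (i + m <= N)%N -> mor_val f i = mor_val g i.
Proof.
elim: m n f g / => /=.
- by [].
- by move=> m n f g _ h i hi; rewrite h.
- by move=> m n f g h _ e1 _ e2 i hi; rewrite e1 ?e2.
- move=> l m n f f' g g' _ e1 _ e2 i hi; rewrite e2 //.
  (* The strand bound concerns the source [l] and passes to [f] only if [l = m]; otherwise the right
     factor has value 0. *)
  have [e|lm] := eqVneq l m; first by rewrite e1 -?e.
  by rewrite (mor_val_neq g') ?mulr0.
- move=> m n m' n' f f' g g' _ e1 _ e2 i hi.
  by rewrite e1 ?e2 //; lia.
- by move=> m n f f' g g' _ e1 _ e2 i hi; rewrite e1 ?e2.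
- by move=> m n c f f' _ e i hi; rewrite e.
- by move=> *; rewrite addrA.
- by move=> *; rewrite addrC.
- by move=> *; rewrite add0r.
- by move=> *; rewrite scalerA.
- by move=> *; rewrite scale1r.
- by move=> *; rewrite scale0r.
- by move=> *; rewrite scalerDr.
- by move=> *; rewrite scalerDl.
- by move=> *; rewrite mulrDl.
- by move=> *; rewrite mulrDr.
- by move=> *; rewrite superAl.
- by move=> *; rewrite superAr.
- by move=> *; rewrite mulrDl.
- by move=> *; rewrite mulrDr.
- by move=> *; rewrite superAl.
- by move=> *; rewrite superAr.
- by move=> *; rewrite mulrA.
- by move=> *; rewrite mul1r.
- by move=> *; rewrite mulr1.
- move=> m n m' n' m'' n'' f g h i _; rewrite mor_val_cast /= mulrA.
  by rewrite addnA addnAC.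
- by move=> *; rewrite mul1r.
- by move=> m n f i _; rewrite mor_val_cast /= mulr1 addn0.
- by move=> *; rewrite mulr1.
- move=> p q l m n l' m' n' f' f g g' hf hg i hi.
  (* The offset of [f'] is [i + m'] on the left and [i + l'] on the right; if these differ, [g'] has
     value 0. *)
  have [e|lm] := eqVneq l' m'; last by rewrite (mor_val_neq g') ?mulr0 ?scaler0.
  subst m'; rewrite -!mulrA -superAr; congr (_ * _).
  rewrite !mulrA -superAl; congr (_ * _).
  rewrite (mor_val_comm hg hf) ?(sgnC _ p) //; lia.
- by move=> i hi; rewrite (sam1 (ncf_sam fam _)) //; lia.
- move=> c d a b i hi; have hT : sa_morph (T i) by apply: (ncf_sam fam); lia.
  by rewrite (samD hT) !(samZ hT).
- by move=> a b i hi; rewrite (samM (ncf_sam fam _)) //; lia.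
- by move=> i hi; rewrite (ncf_sq fam) //; lia.
- by move=> i hi; rewrite !mulr1 !mul1r addn1 !mulrA (ncf_braid fam) //; lia.
- move=> a i hi; rewrite mulr1 mul1r addn1 (ncf_slide fam); try lia.
  by rewrite /swap_index eqxx ifF //; lia.
- move=> a i hi; rewrite mulr1 mul1r addn1 (ncf_slide fam); try lia.
  by rewrite /swap_index eqxx.
Qed.

Definition nilcox_val (x : nilCox A N) : B :=
  mor_val (rep (M := mor_setoid A N N) x) 0.

Lemma nilcox_valE f : nilcox_val (ncls f) = mor_val f 0.
Proof. by apply: mor_valP => //; apply: (rep_cls (M := mor_setoid A N N)). Qed.

Lemma nilcox_valP : sa_morph nilcox_val.
Proof.
have hD : {morph nilcox_val : x y / x + y}.
  elim/nclsW=> f; elim/nclsW=> g.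
  by rewrite -[_ + _](nclsD f g) !nilcox_valE.
split=> //.
- by move=> c; elim/nclsW=> f; rewrite -[_ *: _](nclsZ c f) !nilcox_valE.
- by rewrite -[1]/(nid A N) nilcox_valE.
- elim/nclsW=> f; elim/nclsW=> g.
  by rewrite [_ * _](ncompE f g) !nilcox_valE.
- move=> p x.
  (* A homogeneous component has a syntactically homogeneous representative, whose value is
     homogeneous; the components of the value can then be read off. *)
  have hh q : homog q (nilcox_val (hcomp q x)).
    elim/nclsW: x => f; rewrite [hcomp _ _](nhcompE q f).
    have [f' hf' <-] := nproj_rep f q.
    by rewrite nilcox_valE; apply: mor_val_homog.
  rewrite -{2}[x]hcomp_sum hD hcompD !(homog_neq _ (hh _)).
  by case: p; rewrite /= ?addr0 ?add0r.
Qed.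

Lemma nilcox_val_crossing (i : 'I_N.-1) : nilcox_val (crossing A i) = U i.
Proof.
rewrite /crossing (ntensE (mId _ _)) ntensE ncastE nilcox_valE mor_val_cast /=.
by rewrite mul1r mulr1.
Qed.

Lemma nilcox_val_token (i : 'I_N) a : nilcox_val (token i a) = T i a.
Proof.
rewrite /token (ntensE (mId _ _)) ntensE ncastE nilcox_valE mor_val_cast /=.
by rewrite mul1r mulr1.
Qed.

End MorphismValue.

(** * The family of crossings and tokens in the category *)

Section Placement.
Variables (k : comPzRingType) (A : superAlgType k).
Local Notation nHom := (nHom A).
Local Notation nid := (nid A).

(** Unlike [homog], this applies to all Hom modules, not only to the endomorphism superalgebras. *)
Definition nhomog m n p (x : nHom m n) := exists2 f, mhomog f p & ncls f = x.

Lemma nHom_split m n (x : nHom m n) :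
  exists x0 x1, [/\ nhomog false x0, nhomog true x1 & x = x0 + x1].
Proof.
elim/nclsW: x => f; exists (nproj false f), (nproj true f).
by rewrite nproj_sum; split=> //; apply: nproj_rep.
Qed.

Lemma nhomog_id n : nhomog false (nid n).
Proof. by exists (mId A n). Qed.

Lemma nhomog_tens m n m' n' p q (f : nHom m n) (g : nHom m' n') :
  nhomog p f -> nhomog q g -> nhomog (p (+) q) (ntens f g).
Proof.
move=> [f' hf <-] [g' hg <-]; exists (mTens f' g'); last by rewrite ntensE.
by exists p; rewrite addbC addKb.
Qed.

Lemma ntens_interchange p q l m n l' m' n' (f' : nHom m n) (f : nHom l m)
    (g : nHom m' n') (g' : nHom l' m') : nhomog p f -> nhomog q g ->
  ncomp (ntens f' g) (ntens f g') =
  sgn k p q *: ntens (ncomp f' f) (ncomp g g').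
Proof. by move=> [f0 hf <-] [g0 hg <-]; apply: ninterchange. Qed.

Lemma ntens_id m n : ntens (nid m) (nid n) = nid (m + n).
Proof. by rewrite [LHS]ntensE; apply/nclsP/me_tens_id. Qed.

(** Interchange with an identity has no sign, identities being even; splitting [f] into components
    removes the homogeneity assumption. *)
Lemma ntens_comp_idl l m n l' m' (f' : nHom m n) (f : nHom l m)
    (g' : nHom l' m') :
  ncomp (ntens f' (nid m')) (ntens f g') = ntens (ncomp f' f) g'.
Proof.
have [f0 [f1 [h0 h1 ->]]] := nHom_split f.
rewrite ntensDl !ncompDr ntensDl (ntens_interchange _ _ h0 (nhomog_id _)).
by rewrite (ntens_interchange _ _ h1 (nhomog_id _)) /sgn /= !scale1r ncomp_idl.
Qed.

Lemma ntens_comp_idr m n l' m' n' (f' : nHom m n) (g : nHom m' n')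
    (g' : nHom l' m') :
  ncomp (ntens f' g) (ntens (nid m) g') = ntens f' (ncomp g g').
Proof.
have [g0 [g1 [h0 h1 ->]]] := nHom_split g.
rewrite ntensDr !ncompDl ntensDr (ntens_interchange _ _ (nhomog_id _) h0).
by rewrite (ntens_interchange _ _ (nhomog_id _) h1) /sgn /= !scale1r ncomp_idr.
Qed.

Lemma ncast_irr m n m' n' (em em' : m = m') (en en' : n = n') (f : nHom m n) :
  ncast em en f = ncast em' en' f.
Proof. by rewrite (eq_irrelevance em em') (eq_irrelevance en en'). Qed.

Lemma ncast_id m n (em : m = m) (en : n = n) (f : nHom m n) : ncast em en f = f.
Proof. exact: (ncast_irr _ (erefl m) _ (erefl n)). Qed.

Lemma ncast_trans m n m' n' m'' n'' (em : m = m') (en : n = n') (em' : m' = m'')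
    (en' : n' = n'') (f : nHom m n) :
  ncast em' en' (ncast em en f) = ncast (etrans em em') (etrans en en') f.
Proof. by case: m'' / em'; case: n'' / en'. Qed.

Lemma ncastZ m n m' n' (em : m = m') (en : n = n') c (f : nHom m n) :
  ncast em en (c *: f) = c *: ncast em en f.
Proof. by case: m' / em; case: n' / en. Qed.

Lemma ncast_ncomp m n (e : m = n) (f g : nHom m m) :
  ncast e e (ncomp f g) = ncomp (ncast e e f) (ncast e e g).
Proof. by case: n / e. Qed.

Lemma ncast_nid m n (e : m = n) : ncast e e (nid m) = nid n.
Proof. by case: n / e. Qed.

Lemma nhomog_cast m n p (e : m = n) (f : nHom m m) :
  nhomog p f -> nhomog p (ncast e e f).
Proof. by case: n / e. Qed.

Lemma ntens_castl m n m' n' p q (em : m = m') (en : n = n') (f : nHom m n)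
    (g : nHom p q) :
  ntens (ncast em en f) g =
  ncast (congr1 (addn^~ p) em) (congr1 (addn^~ q) en) (ntens f g).
Proof. by case: m' / em; case: n' / en. Qed.

(** The counterpart of [mor_val_neq] in the category, for the same reason. *)
Lemma nHom_neq m n (x : nHom m n) : m != n -> x = 0.
Proof.
elim/nclsW: x; elim: m n / => /=.
- by move=> n; rewrite eqxx.
- move=> l m n f hf g hg ln; rewrite -ncompE; have [e|lm] := eqVneq l m.
    by rewrite hf ?ncomp0l // -e.
  by rewrite hg ?ncomp0r.
- move=> m n m' n' f hf g hg mn; rewrite -ntensE; have [e|lm] := eqVneq m n.
    by rewrite hg ?ntens0r //; apply: contra mn => /eqP ->; rewrite e.
  by rewrite hf ?ntens0l.
- by [].
- by [].
- by [].
- by move=> m n f hf g hg mn; rewrite nclsD hf // hg // addr0.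
- by move=> m n c f hf mn; rewrite nclsZ hf // scaler0.
Qed.

Variable N : nat.

Definition place r i m (e : (r + m + i)%N = N) (f : nHom m m) : nilCox A N :=
  ncast e e (ntens (ntens (nid r) f) (nid i)).

(* f on the strands i, ..., i + m - 1 of I^(x)N; 0 when i + m > N. *)
Definition at_strand m i (f : nHom m m) : nilCox A N :=
  if (N - (i + m) + m + i)%N =P N is ReflectT e then place e f else 0.

Lemma at_strandE r i m (e : (r + m + i)%N = N) (f : nHom m m) :
  at_strand i f = place e f.
Proof.
rewrite /at_strand; case: eqP => [e'|]; last by lia.
have er : (N - (i + m))%N = r by lia.
by case: r / er e => e; rewrite (eq_irrelevance e' e).
Qed.

Lemma at_strandP i m : (i + m <= N)%N -> exists r, (r + m + i)%N = N.
Proof. by move=> h; exists (N - (i + m))%N; lia. Qed.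

Lemma at_strand_lin i m : is_lin (@at_strand m i).
Proof.
split=> *; rewrite /at_strand; case: eqP => [e|_]; rewrite ?addr0 ?scaler0 //.
  by rewrite /place ntensDr ntensDl ncastD.
by rewrite /place ntensZr ntensZl ncastZ.
Qed.

Lemma at_strand_id i m : (i + m <= N)%N -> at_strand i (nid m) = 1.
Proof.
move=> /at_strandP[r e]; rewrite (at_strandE e) /place !ntens_id.
exact: ncast_nid.
Qed.

Lemma at_strand_comp i m (f g : nHom m m) : (i + m <= N)%N ->
  at_strand i (ncomp f g) = at_strand i f * at_strand i g.
Proof.
move=> /at_strandP[r e]; rewrite !(at_strandE e) /place.
by rewrite -ntens_comp_idr -ntens_comp_idl ncast_ncomp.
Qed.

Lemma at_strand_homog i m p (f : nHom m m) : (i + m <= N)%N -> nhomog p f ->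
  homog p (at_strand i f).
Proof.
move=> /at_strandP[r e] hf; rewrite (at_strandE e) /place.
have := nhomog_cast e (nhomog_tens (nhomog_tens (nhomog_id r) hf) (nhomog_id i)).
rewrite addbF /= => -[F hF <-]; rewrite /homog -[LHS]/(nhcomp _ _) nhcompE.
by rewrite (nproj_homog _ hF) eqxx.
Qed.

Lemma at_strand_tensl i s m (f : nHom m m) : (i + (s + m) <= N)%N ->
  at_strand i (ntens (nid s) f) = at_strand i f.
Proof.
move=> /at_strandP[r e]; have e' : (r + s + m + i)%N = N by lia.
rewrite (at_strandE e) (at_strandE e') /place -ntens_id.
rewrite -[ntens (ntens (nid r) (nid s)) f]ntensA.
by rewrite ntens_castl ncast_trans; apply: ncast_irr.
Qed.

Lemma at_strand_tensr i s m (f : nHom m m) : (i + (m + s) <= N)%N ->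
  at_strand i (ntens f (nid s)) = at_strand (s + i) f.
Proof.
move=> /at_strandP[r e]; have e' : (r + m + (s + i))%N = N by lia.
rewrite (at_strandE e) (at_strandE e') /place -ntens_id.
have -> : ntens (nid r) (ntens f (nid s)) =
    ncast (esym (addnA r m s)) (esym (addnA r m s))
      (ntens (ntens (nid r) f) (nid s)).
  by rewrite -ntensA ncast_trans ncast_id.
rewrite ntens_castl -ntensA !ncast_trans; apply: ncast_irr.
Qed.

(** Interchange writes [f] tensor [g] as [f] tensor 1 after 1 tensor [g]. The tensor clause of
    [mor_val] is modelled on this identity. *)
Lemma at_strand_tens i m m' (f : nHom m m) (g : nHom m' m') :
  (i + (m + m') <= N)%N ->
  at_strand i (ntens f g) = at_strand (i + m') f * at_strand i g.
Proof.
move=> hi; rewrite -[f in LHS]ncomp_idr -ntens_comp_idl at_strand_comp //.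
by rewrite at_strand_tensr // at_strand_tensl // addnC.
Qed.

(** Both morphisms are drawn in one block of strands, with [s] identity strands filling the gap; the
    sign is that of the super interchange law. *)
Lemma at_strand_comm i j m m' p q (f : nHom m m) (g : nHom m' m') :
  nhomog p f -> nhomog q g -> (i + m <= j)%N -> (j + m' <= N)%N ->
  at_strand i f * at_strand j g = sgn k p q *: (at_strand j g * at_strand i f).
Proof.
move=> hf hg hij hj; set s := (j - (i + m))%N.
have hN : (i + (m' + (s + m)) <= N)%N by lia.
have hs := nhomog_tens (nhomog_id s) hf; rewrite addFb in hs.
have -> : at_strand i f = at_strand i (ntens (nid s) f).
  by rewrite at_strand_tensl //; lia.
have -> : j = (i + (s + m))%N by lia.
rewrite -at_strand_tens // -[X in X * _](at_strand_tensl (s := m')) //.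
rewrite (_ : at_strand _ g = at_strand i (ntens g (nid (s + m)))); last first.
  by rewrite at_strand_tensr // addnC.
rewrite -at_strand_comp // (ntens_interchange _ _ hg hs).
by rewrite ncomp_idl ncomp_idr sgnC (linZ (at_strand_lin _ _)).
Qed.

Lemma at_strand0 (f : nHom N N) : at_strand 0 f = f.
Proof.
have e : (0 + N + 0 = N)%N by rewrite addn0.
rewrite (at_strandE e) /place ntens_idl -[RHS]ntens_idr.
exact: ncast_irr.
Qed.

Lemma ntok_lin : is_lin (@ntok k A).
Proof.
split=> [a b|c a]; first exact: ntokD.
by rewrite -[c *: a]addr0 -(scale0r (0 : A)) ntokDZ !scale0r addr0.
Qed.

Definition cat_tok i (a : A) : nilCox A N := at_strand i (ntok a).
Definition cat_cross i : nilCox A N := at_strand i (nX A).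

Lemma nhomog_tok p (a : A) : homog p a -> nhomog p (ntok a).
Proof. by move=> ha; exists (mTok a). Qed.

Lemma nhomog_X : nhomog false (nX A).
Proof. by exists (mX A). Qed.

Lemma cat_tok_lin i : is_lin (cat_tok i).
Proof. exact: lin_comp (at_strand_lin _ _) ntok_lin. Qed.

Lemma cat_tok_sam i : (i < N)%N -> sa_morph (cat_tok i).
Proof.
move=> hi; have hi' : (i + 1 <= N)%N by lia.
have hL := cat_tok_lin i.
split=> [a b|c a||a b|p a].
- exact: linD.
- exact: linZ.
- rewrite -(at_strand_id hi') /cat_tok; congr at_strand.
  exact/nclsP/me_tok1.
- rewrite /cat_tok -at_strand_comp //; congr at_strand.
  by rewrite [RHS]ncompE; apply/esym/nclsP/me_tokM.
- have hh q : homog q (cat_tok i (hcomp q a)).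
    exact: at_strand_homog (nhomog_tok (homog_hcomp _ _)).
  rewrite -{2}[a]hcomp_sum (linD hL) hcompD !(homog_neq _ (hh _)).
  by case: p; rewrite /= ?addr0 ?add0r.
Qed.

Lemma cat_tok_comm i j p q (a b : A) : (i < N)%N -> (j < N)%N -> i != j ->
  homog p a -> homog q b ->
  cat_tok i a * cat_tok j b = sgn k p q *: (cat_tok j b * cat_tok i a).
Proof.
move=> hi hj ij /nhomog_tok ha /nhomog_tok hb.
case: (ltngtP i j) ij => // h _; first by apply: at_strand_comm => //; lia.
rewrite /cat_tok (at_strand_comm hb ha (i := j) (j := i)); try lia.
by rewrite scalerA sgnC sgnK scale1r.
Qed.

Lemma cat_cross_tok_far i j (a : A) : (i.+1 < N)%N -> (j < N)%N ->
  j != i -> j != i.+1 -> cat_cross i * cat_tok j a = cat_tok j a * cat_cross i.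
Proof.
move=> hi hj ji ji'; have hL := cat_tok_lin j; move: a.
apply: (lin_homog_eq (lin_comp (mull_lin _) hL) (lin_comp (mulr_lin _) hL)).
move=> p a /nhomog_tok ha; have hX := nhomog_X; rewrite /cat_cross /cat_tok.
have [h|h] : (j < i)%N \/ (i.+1 < j)%N by lia.
  by rewrite (at_strand_comm ha hX (i := j)) ?/sgn ?andbF ?scale1r //; lia.
by rewrite (at_strand_comm hX ha (i := i)) ?/sgn ?scale1r //; lia.
Qed.

Lemma cat_family : nilcox_family N cat_tok cat_cross.
Proof.
have hX := nhomog_X.
split; first exact: cat_tok_sam; first exact: cat_tok_comm.
- by move=> i hi; apply: at_strand_homog => //; lia.
- move=> i hi; rewrite /cat_cross -at_strand_comp; last by lia.
  rewrite (_ : ncomp _ _ = 0) ?(lin0 (at_strand_lin _ _)) //.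
  by rewrite [LHS]ncompE; apply/nclsP/me_XX.
- move=> i j ij hj; rewrite /cat_cross (at_strand_comm hX hX (i := i)); try lia.
  by rewrite scale1r.
- move=> i hi; have h3 : (i + 3 <= N)%N by lia.
  (* The braid relation is checked in a block of three strands starting at [i]. Strands count from
     the right, so the lower crossing has its identity strand on the left. *)
  have e0 : cat_cross i = at_strand i (ntens (nid 1) (nX A)).
    by rewrite at_strand_tensl.
  have e1 : cat_cross i.+1 = at_strand i (ntens (nX A) (nid 1)).
    by rewrite at_strand_tensr.
  rewrite e0 e1 -!at_strand_comp // -!ncompA; congr at_strand.
  have /nclsP := me_braid A.
  rewrite -!ncompE -!(ntensE (mX A) (mId A 1)) -!(ntensE (mId A 1) (mX A)) => h.
  exact: esym h.
- move=> i j a hi hj; have h2 : (i + 2 <= N)%N by lia.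
  have e0 : cat_tok i a = at_strand i (ntens (nid 1) (ntok a)).
    by rewrite at_strand_tensl.
  have e1 : cat_tok i.+1 a = at_strand i (ntens (ntok a) (nid 1)).
    by rewrite at_strand_tensr.
  rewrite /swap_index; case: eqP => [->|/eqP ji].
    rewrite e0 e1 -!at_strand_comp //; congr at_strand.
    rewrite [ntens (nid 1) _]ntensE [ntens _ (nid 1)]ntensE.
    by rewrite [LHS]ncompE [RHS]ncompE; apply/nclsP/me_slide_r.
  case: eqP => [->|/eqP ji']; last exact: cat_cross_tok_far.
  rewrite e0 e1 -!at_strand_comp //; congr at_strand.
  rewrite [ntens (nid 1) _]ntensE [ntens _ (nid 1)]ntensE.
  by rewrite [LHS]ncompE [RHS]ncompE; apply/nclsP/me_slide_l.
Qed.

Local Arguments ncast : simpl never.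

(** Evaluation in the category's own family draws the morphism back on its strands. The cast along
    [e] is needed because the ends of [f] are equal only propositionally, while [at_strand] takes
    endomorphisms. *)
Lemma cat_mor_val m n (f : mor A m n) i (e : n = m) : (i + m <= N)%N ->
  mor_val cat_tok cat_cross f i = at_strand i (ncast (erefl m) e (ncls f)).
Proof.
elim: m n / f i e => /=.
- by move=> n i e hi; rewrite ncast_id at_strand_id.
- move=> l m n f hf g hg i e hi; subst n.
  have [e|lm] := eqVneq l m; last first.
    rewrite (mor_val_neq _ _ g) // mulr0 ncast_id -ncompE (nHom_neq (ncls g)) //.
    by rewrite ncomp0r (lin0 (at_strand_lin _ _)).
  subst m; rewrite ncast_id -ncompE at_strand_comp //.
  by rewrite (hf _ erefl) // (hg _ erefl).
- move=> m n m' n' f hf g hg i e hi.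
  (* Only the total numbers of strands are known to agree; if those of the left factors differ, both
     sides are zero. *)
  have [e1|mn] := eqVneq m n; last first.
    rewrite (mor_val_neq _ _ f) // mul0r -ntensE (nHom_neq (ncls f)) //.
    by rewrite ntens0l ncast0 (lin0 (at_strand_lin _ _)).
  subst n; have e2 : n' = m' by lia.
  subst n'; rewrite ncast_id -ntensE at_strand_tens //.
  by rewrite (hf _ erefl) ?(hg _ erefl) //; lia.
- by move=> i e hi; rewrite ncast_id.
- by move=> a i e hi; rewrite ncast_id.
- by move=> m n i e hi; rewrite ncls0 ncast0 (lin0 (at_strand_lin _ _)).
- move=> m n f hf g hg i e hi.
  by rewrite nclsD ncastD (linD (at_strand_lin _ _)) (hf _ e) // (hg _ e).
- move=> m n c f hf i e hi.
  by rewrite nclsZ ncastZ (linZ (at_strand_lin _ _)) (hf _ e).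
Qed.

Lemma cat_tokE (i : 'I_N) (a : A) : cat_tok i a = token i a.
Proof. exact: at_strandE (token_dim i) _. Qed.

Lemma cat_crossE (i : 'I_N.-1) : cat_cross i = crossing A i.
Proof. exact: at_strandE (crossing_dim i) _. Qed.

End Placement.

(** Evaluation is natural in the family; this is what computes the composite on the category's
    side. *)
Lemma mor_val_map (k : comPzRingType) (A B C : superAlgType k) (g : B -> C) N
    (T : nat -> A -> B) (U : nat -> B) (T' : nat -> A -> C) (U' : nat -> C) :
  sa_morph g -> (forall i a, (i < N)%N -> g (T i a) = T' i a) ->
  (forall i, (i.+1 < N)%N -> g (U i) = U' i) ->
  forall m n (f : mor A m n) i, (i + m <= N)%N ->
    g (mor_val T U f i) = mor_val T' U' f i.
Proof.
move=> hg gT gU m n; elim: m n / => /=.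
- by move=> n i _; rewrite (sam1 hg).
- move=> l m n f hf f' hf' i hi; have [e|lm] := eqVneq l m.
    by rewrite (samM hg) hf ?hf' // -e.
  by rewrite !(mor_val_neq _ _ f') // !mulr0 (sam0 hg).
- move=> m n m' n' f hf f' hf' i hi.
  by rewrite (samM hg) hf ?hf' //; lia.
- by move=> i hi; apply: gU; lia.
- by move=> a i hi; apply: gT; lia.
- by move=> *; rewrite (sam0 hg).
- by move=> m n f hf f' hf' i hi; rewrite (samD hg) hf ?hf'.
- by move=> m n c f hf i hi; rewrite (samZ hg) hf.
Qed.

Theorem proposition4p2 (k : comPzRingType) (A : superAlgType k)
    (eps : bool) (tr : {scalar A}) (frobA : symFrobenius eps tr) (n : nat) :
  exists phi : {rmorphism nilCoxPres A n -> nilCox A n},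
    [/\ scalable phi,
        forall p x, phi (hcomp p x) = hcomp p (phi x),
        bijective phi,
        forall i : 'I_n.-1, phi (pres_u A i) = crossing A i
      & forall (i : 'I_n) (a : A), phi (pres_in (tpow_at n i a)) = token i a].
Proof.
have famC := cat_family A n; have famP := pres_family A n.
pose phi := @pres_lift k A (nilCox A n) n (@cat_tok k A n) (@cat_cross k A n).
pose psi :=
  @nilcox_val k A (nilCoxPres A n) n (@pres_tok k A n) (@pres_cross k A n).
have hphi : sa_morph phi by apply: pres_liftP.
have hpsi : sa_morph psi by apply: nilcox_valP.
have phi_u i : phi (pres_u A i) = crossing A i.
  by rewrite /phi pres_lift_u // cat_crossE.
have phi_t (i : 'I_n) a : phi (pres_in (tpow_at n i a)) = token i a.
  by rewrite /phi pres_lift_at // cat_tokE.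
have phiK : cancel phi psi.
  apply: (pres_ext (sam_comp hpsi hphi) (sam_id _)) => [i|i a hi] /=.
    by rewrite phi_u /psi nilcox_val_crossing // pres_crossE.
  by rewrite (phi_t (Ordinal hi)) /psi (nilcox_val_token famP).
have psiK : cancel psi phi.
  elim/nclsW => f; rewrite /psi nilcox_valE //.
  (* [phi] carries the family of the presentation to that of the category, so the value of [f]
     becomes its value there, which is [f] on all [n] strands. *)
  rewrite (mor_val_map hphi (N := n) (T' := @cat_tok k A n)
    (U' := @cat_cross k A n)) //.
  - by rewrite (cat_mor_val f erefl) // at_strand0.
  - by move=> i a hi; rewrite -(pres_lift_at famC a hi).
  - move=> i hi; have hi' : (i < n.-1)%N by lia.
    by rewrite (pres_crossE _ (Ordinal hi')) -(pres_lift_u famC (Ordinal hi')).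
have phi_zmod : zmod_morphism phi by exact: samB.
have phi_mon : monoid_morphism phi by split; [apply: sam1 | apply: samM].
pose phiA := GRing.isZmodMorphism.Build _ _ phi phi_zmod.
pose phiM := GRing.isMonoidMorphism.Build _ _ phi phi_mon.
pose F : {rmorphism nilCoxPres A n -> nilCox A n} := HB.pack phi phiA phiM.
exists F; split=> //.
- by move=> c x; apply: (samZ hphi).
- by move=> p x; apply: (samH hphi).
- by exists psi.
Qed.
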